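(* For each fixed $T>0$, $$\mathcal{R}^\ell=\{f\in hol(D^\ell_\infty):\ f(z+2)=f(z)=-f(-z)\ \text{ for all } z\in D^\ell_\infty,\ f|_D\in \mathcal{H}^\ell_T(D)\},$$ where $\mathcal{H}^\ell_T(D)$ is the reproducing kernel Hilbert space of analytic functions on $D$ with reproducing kernel $$\mathcal{K}_\ell(z,w;T)=\sum_{m,n\in\mathbb{Z}}\mathcal{K}_0(z+2n,w+2m;T),\qquad z,w\in D.$$ The space $\mathcal{H}^\ell_T(D)$ is endowed with the norm $$\|f\|_{\mathcal{H}^\ell_T(D)}=\inf\{\|u\|_{L^2_{\mathbb{C}}(0,T)}:\ f=-2\mathcal{L}^\ell_T u,\ u\in L^2_{\mathbb{C}}(0,T)\}.$$
   Context: Identify $\mathbb{R}^2$ with $\mathbb{C}$. Let $D=\{x+iy: |y|<x,\ |y|<2-x\}$ and $D^\ell_\infty=\bigcup_{n\in\mathbb{Z}}(2n+D)$. For an open set $\Omega\subset\mathbb{C}$, $hol(\Omega)$ is the set of analytic functions on $\Omega$. $L^2_{\mathbb{C}}(0,T)$ is the space of complex-valued square integrable functions on $(0,T)$. Kernel: $$\mathcal{K}_0(z,w;T)=\frac{z\overline{w}}{\pi}e^{-\frac{z^2+\overline{w}^2}{4T}}\left(\frac{1}{(z^2+\overline{w}^2)^2}+\frac{1}{4T(z^2+\overline{w}^2)}\right)$$ whenever $z^2+\overline{w}^2\neq 0$. Heat kernel: $K(x,t)=\frac{1}{\sqrt{4\pi t}}e^{-x^2/(4t)}$ for $t>0$;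 $\theta(x,t)=\sum_{n\in\mathbb{Z}}K(x+2n,t)$; for $z\in\mathbb{C}$, $(\partial_xK)(z,t)=-\frac{z}{4\sqrt{\pi}\,t^{3/2}}e^{-z^2/(4t)}$, and $(\partial_x\theta)(z,t)=\sum_{n\in\mathbb{Z}}(\partial_xK)(z+2n,t)$. Control system: $\partial_tw-\partial_{xx}w=0$ for $0<x<1$, $0<t<T$; $w(0,t)=u_\ell(t)$, $w(1,t)=u_r(t)$ for $0<t<T$; $w(x,0)=0$ for $0<x<1$. For $u_\ell,u_r\in L^2_{\mathbb{C}}(0,T)$ its solution is the unique $w\in C([0,T],W^{-1,2}(0,1))$ given by $$w(x,t)=-2\int_0^t(\partial_x\theta)(x,t-\tau)u_\ell(\tau)\,d\tau+2\int_0^t(\partial_x\theta)(x-1,t-\tau)u_r(\tau)\,d\tau.$$ $\mathcal{R}^\ell_T$ is the set of all $w(\cdot,T)$ where $w$ is the solution with $u_\ell\in L^2_{\mathbb{C}}(0,T)$ and $u_r\equiv0$. It does not depend on $T>0$ and is denoted $\mathcal{R}^\ell$. Elements of $\mathcal{R}^\ell$ are identified with their analytic extensions from $(0,1)$ to $D^\ell_\infty$ given by the same integral formula with $x$ replaced by $z\in D^\ell_\infty$. The operator $\mathcal{L}^\ell_T:L^2_{\mathbb{C}}(0,T)\to hol(D)$ is $(\mathcal{L}^\ell_Tu)(z)=\int_0^T(\partial_x\theta)(z,T-\tau)u(\tau)\,d\tau$, $z\in D$.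
   Formalization: As printed, the norm inf{‖u‖ : f = −2Lu} has reproducing kernel 4K_ℓ, not K_ℓ; the theorem keeps H as the RKHS with kernel K_ℓ, and proves that the printed norm is a Hilbert norm on H equal to half of the norm for which K_ℓ is reproducing. *)

(* Defs.v *)
From HB Require Import structures.
From mathcomp Require Import all_boot all_order all_algebra.
From mathcomp Require Export complex.
From mathcomp Require Import all_classical all_reals all_analysis.

Set Implicit Arguments.
Unset Strict Implicit.
Unset Printing Implicit Defensive.

Import Order.TTheory GRing.Theory Num.Theory.
Import numFieldNormedType.Exports.

Local Open Scope classical_set_scope.
Local Open Scope complex_scope.
Local Open Scope ring_scope.

Definition diamond {R : realType} : set R[i] :=
  [set z | `|complex.Im z| < complex.Re z /\ `|complex.Im z| < 2 - complex.Re z].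

Definition diamond_chain {R : realType} : set R[i] :=
  \bigcup_(n in [set: int]) [set 2 * n%:~R + z | z in diamond].

(** On the complex line [R[i]^o], with its norm topology, [derivable f z 1] is
    complex differentiability at [z].  [X] is meant to be open, so that the
    values of [f] off [X] are irrelevant. *)
Definition hol {R : realType} (X : set R[i]) : set (R[i] -> R[i]) :=
  [set f | forall z, X z -> derivable (f : R[i]^o -> R[i]^o) z 1].

Definition cintegral {R : realType} (A : set R) (g : R -> R[i]) : R[i] :=
  (\int[lebesgue_measure]_(t in A) complex.Re (g t)) +i*
  (\int[lebesgue_measure]_(t in A) complex.Im (g t)).

(** The value of the unordered sum of an absolutely summable family; meaningless
    for other families. *)
Definition rsum {R : realType} {I : choiceType} (a : I -> R) : R :=
  fine (\esum_(i in [set: I]) (EFin \o a)^\+ i -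
        \esum_(i in [set: I]) (EFin \o a)^\- i)%E.

Definition csum {R : realType} {I : choiceType} (a : I -> R[i]) : R[i] :=
  rsum (fun i => complex.Re (a i)) +i* rsum (fun i => complex.Im (a i)).

Definition cexp {R : realType} (z : R[i]) : R[i] :=
  (expR (complex.Re z))%:C * (cos (complex.Im z) +i* sin (complex.Im z)).

Definition sqnorm {R : realType} (z : R[i]) : R :=
  complex.Re z ^+ 2 + complex.Im z ^+ 2.

Definition L2 {R : realType} (T : R) : set (R -> R[i]) :=
  [set u | [/\ measurable_fun `]0, T[ (fun t => complex.Re (u t)),
               measurable_fun `]0, T[ (fun t => complex.Im (u t)) &
      (\int[lebesgue_measure]_(t in `]0%R, T[) (sqnorm (u t))%:E < +oo)%E]].

Definition L2norm {R : realType} (T : R) (u : R -> R[i]) : R :=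
  Num.sqrt (\int[lebesgue_measure]_(t in `]0, T[) sqnorm (u t)).

(** The spatial derivatives of the heat kernel [K] and of its 2-periodization
    [theta], with complex space variable; meant for [0 < t]. *)
Definition dxK {R : realType} (z : R[i]) (t : R) : R[i] :=
  - (z / (4 * Num.sqrt pi * t `^ (3 / 2))%:C) * cexp (- (z ^+ 2 / (4 * t)%:C)).

Definition dxtheta {R : realType} (z : R[i]) (t : R) : R[i] :=
  csum (fun n : int => dxK (z + 2 * n%:~R) t).

(** The solution with controls [ul] at 0 and [ur] at 1; it is evaluated at
    complex [z], and [z] real in (0, 1) gives the state of the system. *)
Definition heat_solution {R : realType} (ul ur : R -> R[i]) (z : R[i]) (t : R) :
    R[i] :=
  - 2 * cintegral `]0, t[ (fun tau => dxtheta z (t - tau) * ul tau) +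
    2 * cintegral `]0, t[ (fun tau => dxtheta (z - 1) (t - tau) * ur tau).

(** States reachable in time [T] with the right control equal to 0, identified
    with their extensions to [diamond_chain].  For [0 < T] this space is known
    not to depend on [T].  As in [hol], values off the domain are irrelevant. *)
Definition left_reachable {R : realType} (T : R) : set (R[i] -> R[i]) :=
  [set f | exists2 u, L2 T u &
    forall z, diamond_chain z -> f z = heat_solution u (cst 0) z T].

Definition Lop {R : realType} (T : R) (u : R -> R[i]) (z : R[i]) : R[i] :=
  cintegral `]0, T[ (fun tau => dxtheta z (T - tau) * u tau).

(** Infimum over the controls producing [f] on [diamond]; it is [+oo] when there
    is none.  The kernel of [Lop T] composed with its adjoint is [kernel_left T]
    below, so the norm with reproducing kernel [kernel_left T] is the infimum over
    [f = Lop T u]; the factor [- 2] makes [control_norm T f] half of it. *)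
Definition control_norm {R : realType} (T : R) (f : R[i] -> R[i]) : \bar R :=
  ereal_inf [set (L2norm T u)%:E | u in
    [set u | L2 T u /\ forall z, diamond z -> f z = - 2 * Lop T u z]].

Definition kernel0 {R : realType} (T : R) (z w : R[i]) : R[i] :=
  let s := z ^+ 2 + conjc w ^+ 2 in
  z * conjc w / pi%:C * cexp (- (s / (4 * T)%:C)) *
    (1 / s ^+ 2 + 1 / ((4 * T)%:C * s)).

Definition kernel_left {R : realType} (T : R) (z w : R[i]) : R[i] :=
  csum (fun nm : int * int =>
    kernel0 T (z + 2 * nm.1%:~R) (w + 2 * nm.2%:~R)).

(** Hilbert spaces of functions on a set [X].  Functions on [X] are represented
    by total functions that vanish off [X], so that equality of functions on [X]
    is Leibniz equality; [restr X f] represents the restriction of [f]. *)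

Definition restr {R : realType} (X : set R[i]) (f : R[i] -> R[i]) :
    R[i] -> R[i] :=
  patch (cst 0) X f.

Definition hnorm {R : realType}
    (ip : (R[i] -> R[i]) -> (R[i] -> R[i]) -> R[i]) (f : R[i] -> R[i]) : R :=
  Num.sqrt (complex.Re (ip f f)).

Record hilbert_function_space {R : realType} (X : set R[i])
    (H : set (R[i] -> R[i]))
    (ip : (R[i] -> R[i]) -> (R[i] -> R[i]) -> R[i]) : Prop := {
  hfs_restr : forall f, H f -> restr X f = f ;
  hfs_zero : H (cst 0) ;
  hfs_linear : forall (a : R[i]) f g, H f -> H g ->
    H (fun z => a * f z + g z) ;
  hfs_ip_linear : forall (a : R[i]) f g h, H f -> H g -> H h ->
    ip (fun z => a * f z + g z) h = a * ip f h + ip g h ;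
  hfs_ip_conj : forall f g, H f -> H g -> ip g f = conjc (ip f g) ;
  (* in the order of [R[i]], [0 <= c] says that [c] is real and nonnegative *)
  hfs_ip_ge0 : forall f, H f -> 0 <= ip f f ;
  hfs_ip_eq0 : forall f, H f -> ip f f = 0 -> f = cst 0 ;
  hfs_complete : forall u : nat -> R[i] -> R[i], (forall n, H (u n)) ->
    (forall e : R, 0 < e -> exists N, forall m n, (N <= m)%N -> (N <= n)%N ->
       hnorm ip (u m \- u n) < e) ->
    exists2 f, H f & (fun n => hnorm ip (u n \- f)) @ \oo --> (0 : R)
}.

(** [H], with inner product [ip] linear in its first argument, is a reproducing
    kernel Hilbert space of functions on [X] with reproducing kernel [k]. *)
Record rkhs {R : realType} (X : set R[i]) (k : R[i] -> R[i] -> R[i])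
    (H : set (R[i] -> R[i]))
    (ip : (R[i] -> R[i]) -> (R[i] -> R[i]) -> R[i]) : Prop := {
  rkhs_hilbert : hilbert_function_space X H ip ;
  rkhs_kernel : forall w, X w -> H (restr X (fun z => k z w)) ;
  rkhs_reproducing : forall f w, H f -> X w ->
    f w = ip f (restr X (fun z => k z w))
}.

(* Main.v *)
Require Import Defs.
From HB Require Import structures.
From mathcomp Require Import all_boot all_order all_algebra.
From mathcomp Require Import complex.
From mathcomp Require Import ring lra.
From mathcomp Require Import all_classical all_reals all_analysis.
From mathcomp Require Import measurable_realfun.

Set Implicit Arguments.
Unset Strict Implicit.
Unset Printing Implicit Defensive.

Import Order.TTheory GRing.Theory Num.Theory.
Import numFieldNormedType.Exports.

Local Open Scope classical_set_scope.
Local Open Scope complex_scope.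
Local Open Scope ring_scope.

(** A function on the diamond of the form [Lop T u] is the function
    [z |-> <u, representer T z>], an inner product in [L2(0, T)] with the conjugate
    of [t |-> dxtheta z (T - t)].  The kernel [kernel_left T] is the Gram kernel
    [(z, w) |-> <representer T w, representer T z>] of these vectors: for single
    translates, [int_0^T s^-3 exp(-c / s) ds] has an elementary primitive which
    gives [kernel0] ([dxK_kernel0]), and summing over pairs of translates commutes
    with the integral because the terms are dominated, uniformly in time, by a
    summable family ([kernel_leftE]).

    The rest of the description of the norm is soft.  Whenever [K] is the Gram
    kernel of vectors [phi z] of a Hilbert space [S], the space with reproducing
    kernel [K] consists of the functions [z |-> <u, phi z>] with [u] in [S], and
    the norm of such a function is the least norm of such a [u].  Both inclusions
    come from one statement, [gram_transfer]: if two families have the same Gram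
    matrix, then every vector of one space has a counterpart in the other one with
    the same inner products against the family and with no larger norm.  Going
    from the function space to [S] uses that [S] is complete ([rkhs_sub]), and
    going back uses that the function space is complete ([rkhs_sup]); applied
    within [S] it gives the orthogonal projections from which the function space
    is constructed ([rkhs_exists]).  For [S] one takes [L2(0, T)], whose
    completeness is [L2on_complete].

    Analyticity comes from a second-order expansion of each translate of the heat
    kernel with a remainder at most a constant times [|h|^2 (1 + |n|)^-2], valid
    for all times in [(0, T)] ([heat_bounds]): on the diamond and its translates
    the real part of [z^2] is positive, so the Gaussian beats every negative power
    of the time.  Such an expansion survives the sum over translates and the
    integral against a control ([Lop_quad_differentiable]).

    The series [dxtheta] is 2-periodic and odd, hence so is every reachable state
    on the chain of diamonds.  Conversely a 2-periodic function on the chain is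
    determined by its values on one diamond; if these are [Lop T v], then [-v/2]
    is a control which steers to it.  That factor is also the factor 2 between
    the two norms. *)

(** * Complex numbers through their real and imaginary parts *)

Section ComplexBasics.
Context {R : realType}.
Implicit Types (a b z w : R[i]) (x y : R).

Lemma complex_eq z w : complex.Re z = complex.Re w -> complex.Im z = complex.Im w ->
  z = w.
Proof. by case: z w => a b [c d] /= -> ->. Qed.

Lemma ReD z w : complex.Re (z + w) = complex.Re z + complex.Re w.
Proof. by case: z w => a b [c d]. Qed.
Lemma ImD z w : complex.Im (z + w) = complex.Im z + complex.Im w.
Proof. by case: z w => a b [c d]. Qed.
Lemma ReN z : complex.Re (- z) = - complex.Re z. Proof. by case: z. Qed.
Lemma ImN z : complex.Im (- z) = - complex.Im z. Proof. by case: z. Qed.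
Lemma ReM z w : complex.Re (z * w) =
  complex.Re z * complex.Re w - complex.Im z * complex.Im w.
Proof. by case: z w => a b [c d]. Qed.
Lemma ImM z w : complex.Im (z * w) =
  complex.Re z * complex.Im w + complex.Im z * complex.Re w.
Proof. by case: z w => a b [c d]. Qed.
Lemma Re_conjc z : complex.Re (conjc z) = complex.Re z. Proof. by case: z. Qed.
Lemma Im_conjc z : complex.Im (conjc z) = - complex.Im z.
Proof. by case: z. Qed.
Lemma Re_realc x : complex.Re (x%:C) = x. Proof. by []. Qed.
Lemma Im_realc x : complex.Im (x%:C) = 0. Proof. by []. Qed.
Lemma Re_nat n : complex.Re (n%:R : R[i]) = n%:R.
Proof. by elim: n => // n IH; rewrite -addn1 !natrD ReD IH. Qed.
Lemma Im_nat n : complex.Im (n%:R : R[i]) = 0.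
Proof. by elim: n => // n IH; rewrite -addn1 !natrD ImD IH addr0. Qed.
Lemma Re_int (n : int) : complex.Re (n%:~R : R[i]) = n%:~R.
Proof.
by case: n => n; rewrite ?NegzE ?mulrNz ?ReN -pmulrn Re_nat -pmulrn.
Qed.
Lemma Im_int (n : int) : complex.Im (n%:~R : R[i]) = 0.
Proof.
by case: n => n; rewrite ?NegzE ?mulrNz ?ImN -pmulrn Im_nat ?oppr0.
Qed.
Definition ReImE := (ReD, ImD, ReN, ImN, ReM, ImM, Re_conjc, Im_conjc,
  Re_realc, Im_realc, Re_nat, Im_nat, Re_int, Im_int).

Lemma sqnorm_ge0 z : 0 <= sqnorm z.
Proof. by rewrite addr_ge0 ?sqr_ge0. Qed.

Lemma sqnorm_eq0 z : sqnorm z <= 0 -> z = 0.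
Proof.
rewrite /sqnorm => h; apply: complex_eq => /=; apply/eqP.
  by rewrite -sqrf_eq0 eq_le sqr_ge0 (le_trans _ h) // lerDl sqr_ge0.
by rewrite -sqrf_eq0 eq_le sqr_ge0 (le_trans _ h) // lerDr sqr_ge0.
Qed.

Lemma sqnormM z w : sqnorm (z * w) = sqnorm z * sqnorm w.
Proof. rewrite /sqnorm !ReImE; ring. Qed.

Lemma sqnormN z : sqnorm (- z) = sqnorm z.
Proof. by rewrite /sqnorm !ReImE !sqrrN. Qed.

Lemma sqnorm_conjc z : sqnorm (conjc z) = sqnorm z.
Proof. by rewrite /sqnorm !ReImE sqrrN. Qed.

Lemma sqnormD_le z w : sqnorm (z + w) <= 2 * sqnorm z + 2 * sqnorm w.
Proof.
rewrite /sqnorm !ReImE -subr_ge0.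
rewrite [leRHS](_ : _ = (complex.Re z - complex.Re w) ^+ 2 +
  (complex.Im z - complex.Im w) ^+ 2); last by ring.
by rewrite addr_ge0 ?sqr_ge0.
Qed.

(** The discriminant condition for a nonnegative quadratic function of a complex
    variable.  It gives both the Cauchy-Schwarz inequality and the first-order
    condition satisfied by an almost minimal point. *)
Lemma quad_disc x (z : R[i]) y : 0 <= x ->
  (forall a, 0 <= sqnorm a * x + 2 * complex.Re (a * z) + y) ->
  sqnorm z <= x * y.
Proof.
move=> x0 H.
have K t : 0 <= t ^+ 2 * (sqnorm z * x) - 2 * t * sqnorm z + y.
  have := H (- t%:C * conjc z).
  rewrite [X in _ <= X](_ : _ = t ^+ 2 * (sqnorm z * x) - 2 * t * sqnorm z + y) //.
  by rewrite /sqnorm !ReImE; ring.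
have s0 := sqnorm_ge0 z.
have [x00|xp] := eqVneq x 0.
  rewrite x00 mul0r leNgt; apply/negP => sp.
  have := K ((y + 1) / (2 * sqnorm z)).
  rewrite x00 mulr0 mulr0 sub0r.
  rewrite [X in _ <= X](_ : _ = -1); first by lra.
  by field; rewrite gt_eqF.
have xp' : 0 < x by rewrite lt_neqAle eq_sym xp.
have := K x^-1; rewrite [X in _ <= X](_ : _ = y - sqnorm z / x); last by field.
by rewrite subr_ge0 ler_pdivrMr // mulrC.
Qed.

End ComplexBasics.

(** * Pre-Hilbert spaces of functions *)

Section PreHilbert.
Context {R : realType}.
Local Notation C := R[i].

(** The form is only semidefinite, so that square integrable functions need not be
    taken modulo null sets, and the functions live on an arbitrary type, so that
    controls on the time interval and functions of [z] are instances of the same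
    notion. *)
Record pre_hilbert (A : Type) (S : set (A -> C))
    (ip : (A -> C) -> (A -> C) -> C) : Prop := {
  ph_zero : S (cst 0) ;
  ph_linear : forall a f g, S f -> S g -> S (fun z => a * f z + g z) ;
  ph_ipL : forall a f g h, S f -> S g -> S h ->
    ip (fun z => a * f z + g z) h = a * ip f h + ip g h ;
  ph_conj : forall f g, S f -> S g -> ip g f = conjc (ip f g) ;
  ph_ge0 : forall f, S f -> 0 <= ip f f }.

Definition sqn (A : Type) (ip : (A -> C) -> (A -> C) -> C) f : R :=
  complex.Re (ip f f).

Definition complete_space (A : Type) (S : set (A -> C))
    (ip : (A -> C) -> (A -> C) -> C) : Prop :=
  forall u : nat -> A -> C, (forall n, S (u n)) ->
    (forall e : R, 0 < e -> exists N, forall m n, (N <= m)%N -> (N <= n)%N ->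
       sqn ip (u m \- u n) < e) ->
    exists2 f, S f & forall e : R, 0 < e -> exists N, forall n, (N <= n)%N ->
      sqn ip (u n \- f) < e.

Section Theory.
Variables (A : Type) (S : set (A -> C)) (ip : (A -> C) -> (A -> C) -> C).
Hypothesis H : pre_hilbert S ip.

Lemma ph_scale a f : S f -> S (fun z => a * f z).
Proof.
move=> Sf; rewrite (_ : (fun z => _) = fun z => a * f z + (cst 0 : A -> C) z).
  exact: ph_linear H _ _ _ Sf (ph_zero H).
by apply/funext => z; rewrite addr0.
Qed.

Lemma ph_add f g : S f -> S g -> S (f \+ g).
Proof.
move=> Sf Sg; rewrite (_ : (f \+ g) = fun z => 1 * f z + g z).
  exact: ph_linear H _ _ _ Sf Sg.
by apply/funext => z; rewrite mul1r.
Qed.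

Lemma ph_sub f g : S f -> S g -> S (f \- g).
Proof.
move=> Sf Sg; rewrite (_ : (f \- g) = fun z => (-1) * g z + f z).
  exact: ph_linear H _ _ _ Sg Sf.
by apply/funext => z; rewrite mulN1r addrC.
Qed.

Lemma ip0l h : S h -> ip (cst 0) h = 0.
Proof.
move=> Sh; have := ph_ipL H 1 (ph_zero H) (ph_zero H) Sh.
rewrite (_ : (fun z => _) = cst 0); last by apply/funext => z; rewrite mulr0 addr0.
by rewrite mul1r => /eqP; rewrite -subr_eq0 opprD addNKr oppr_eq0 => /eqP.
Qed.

Lemma ipZl a f h : S f -> S h -> ip (fun z => a * f z) h = a * ip f h.
Proof.
move=> Sf Sh; have := ph_ipL H a Sf (ph_zero H) Sh; rewrite ip0l // addr0 => <-.
by congr (ip _ h); apply/funext => z; rewrite addr0.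
Qed.

Lemma ipBl f g h : S f -> S g -> S h -> ip (f \- g) h = ip f h - ip g h.
Proof.
move=> Sf Sg Sh; have := ph_ipL H (-1) Sg Sf Sh; rewrite mulN1r addrC => <-.
by congr (ip _ h); apply/funext => z; rewrite mulN1r addrC.
Qed.

Lemma ip0r h : S h -> ip h (cst 0) = 0.
Proof. by move=> Sh; rewrite (ph_conj H (ph_zero H) Sh) ip0l // conjc0. Qed.

Lemma ip_linr a f g h : S f -> S g -> S h ->
  ip h (fun z => a * f z + g z) = conjc a * ip h f + ip h g.
Proof.
move=> Sf Sg Sh; rewrite (ph_conj H (ph_linear H a Sf Sg) Sh) (ph_ipL H) //.
by rewrite rmorphD rmorphM /= -!(ph_conj H).
Qed.

Lemma sqn_ge0 f : S f -> 0 <= sqn ip f.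
Proof. by move=> Sf; have := ph_ge0 H Sf; rewrite lecE /= => /andP[]. Qed.

Lemma ip_sqn f : S f -> ip f f = (sqn ip f)%:C.
Proof.
move=> Sf; have := ph_ge0 H Sf; rewrite lecE /= => /andP[/eqP h _].
exact: complex_eq.
Qed.

Lemma sqn_lin a f g : S f -> S g -> sqn ip (fun z => a * f z + g z) =
  sqnorm a * sqn ip f + 2 * complex.Re (a * ip f g) + sqn ip g.
Proof.
move=> Sf Sg; rewrite /sqn (ph_ipL H) //; last exact: (ph_linear H).
rewrite !ip_linr // (ph_conj H Sf Sg) !ip_sqn // /sqnorm !ReImE.
rewrite /sqn; ring.
Qed.

Lemma cauchy_schwarz f g : S f -> S g ->
  sqnorm (ip f g) <= sqn ip f * sqn ip g.
Proof.
move=> Sf Sg; apply: quad_disc; first exact: sqn_ge0.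
by move=> a; rewrite -sqn_lin //; exact/sqn_ge0/(ph_linear H).
Qed.

Lemma sqn_scale a f : S f -> sqn ip (fun z => a * f z) = sqnorm a * sqn ip f.
Proof.
move=> Sf; rewrite /sqn ipZl //; last exact: ph_scale.
rewrite (ph_conj H (ph_scale a Sf) Sf) ipZl // ip_sqn // /sqnorm !ReImE /sqn.
ring.
Qed.

Lemma sqnB f g : S f -> S g ->
  sqn ip (f \- g) = sqn ip f - 2 * complex.Re (ip f g) + sqn ip g.
Proof.
move=> Sf Sg; rewrite (_ : f \- g = fun z => (-1) * g z + f z).
  rewrite sqn_lin // (ph_conj H Sf Sg) /sqnorm !ReImE /=; ring.
by apply/funext => z; rewrite mulN1r addrC.
Qed.

Lemma sqnD f g : S f -> S g ->
  sqn ip (f \+ g) = sqn ip f + 2 * complex.Re (ip f g) + sqn ip g.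
Proof.
move=> Sf Sg; rewrite (_ : f \+ g = fun z => 1 * f z + g z).
  rewrite sqn_lin // /sqnorm !ReImE /=; ring.
by apply/funext => z; rewrite mul1r.
Qed.

Lemma sqnC f g : S f -> S g -> sqn ip (f \- g) = sqn ip (g \- f).
Proof.
move=> Sf Sg; rewrite !sqnB // (ph_conj H Sf Sg) !ReImE; ring.
Qed.

Lemma sqnD_le f g : S f -> S g ->
  sqn ip (f \+ g) <= 2 * sqn ip f + 2 * sqn ip g.
Proof.
move=> Sf Sg; have := sqn_ge0 (ph_sub Sf Sg).
by rewrite sqnB // sqnD //; lra.
Qed.

Lemma sqn_tri f g h : S f -> S g -> S h ->
  sqn ip (f \- g) <= 2 * sqn ip (f \- h) + 2 * sqn ip (h \- g).
Proof.
move=> Sf Sg Sh; rewrite (_ : f \- g = (f \- h) \+ (h \- g)).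
  by apply: sqnD_le; apply: ph_sub.
by apply/funext => z /=; rewrite subrKA.
Qed.

Lemma ip_null f g : S f -> S g -> sqn ip f = 0 -> ip f g = 0.
Proof.
move=> Sf Sg f0; apply: sqnorm_eq0.
by have := cauchy_schwarz Sf Sg; rewrite f0 mul0r.
Qed.

(** Finite linear combinations, encoded by lists so that the same list can be
    read in two spaces at once. *)
Definition lincomb (I : Type) (k : I -> A -> C) (l : seq (C * I)) : A -> C :=
  fun x => \sum_(p <- l) p.1 * k p.2 x.

Section Comb.
Variables (I : Type) (k : I -> A -> C).
Hypothesis Sk : forall i, S (k i).

Lemma lincomb_cons p l : lincomb k (p :: l) = fun x => p.1 * k p.2 x + lincomb k l x.
Proof. by apply/funext => x; rewrite /lincomb big_cons. Qed.

Lemma lincomb_nil : lincomb k [::] = cst 0.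
Proof. by apply/funext => x; rewrite /lincomb big_nil. Qed.

Lemma lincomb_in l : S (lincomb k l).
Proof.
elim: l => [|p l IH]; first by rewrite lincomb_nil; exact: ph_zero H.
by rewrite lincomb_cons; exact: (ph_linear H).
Qed.

Definition scale_list (a : C) (l : seq (C * I)) :=
  [seq (a * p.1, p.2) | p <- l].

Lemma lincomb_scale a l : lincomb k (scale_list a l) = fun x => a * lincomb k l x.
Proof.
apply/funext => x; rewrite /lincomb big_map mulr_sumr.
by apply: eq_bigr => p _; rewrite mulrA.
Qed.

Lemma lincomb_lin a l l' : lincomb k (scale_list a l ++ l') =
  fun x => a * lincomb k l x + lincomb k l' x.
Proof.
apply/funext => x; rewrite {1}/lincomb big_cat /=.
by rewrite -/(lincomb k (scale_list a l) x) -/(lincomb k l' x) lincomb_scale.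
Qed.

Lemma ip_lincombl l h : S h ->
  ip (lincomb k l) h = \sum_(p <- l) p.1 * ip (k p.2) h.
Proof.
move=> Sh; elim: l => [|p l IH]; first by rewrite lincomb_nil ip0l ?big_nil.
by rewrite lincomb_cons (ph_ipL H) ?big_cons ?IH //; exact: lincomb_in.
Qed.

Lemma ip_lincombr l h : S h ->
  ip h (lincomb k l) = \sum_(p <- l) conjc p.1 * ip h (k p.2).
Proof.
move=> Sh; elim: l => [|p l IH]; first by rewrite lincomb_nil ip0r ?big_nil.
by rewrite lincomb_cons ip_linr ?big_cons ?IH //; exact: lincomb_in.
Qed.

End Comb.
End Theory.

Lemma le0_eps_scaled (x c : R) : 0 <= c -> (forall e : R, 0 < e -> x <= c * e) ->
  x <= 0.
Proof.
move=> c0 h; apply/ler_addgt0Pl => e e0; rewrite addr0.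
have c1 : 0 < c + 1 by rewrite ltr_wpDl.
apply: (le_trans (h _ (divr_gt0 e0 c1))).
by rewrite mulrCA ger_pMr // ler_pdivrMr // mul1r lerDl.
Qed.

(** The distance from [f] to the span of the [k i] is approached along linear
    combinations which form a Cauchy sequence, by the parallelogram law.  Since the
    Gram matrices agree, the same coefficients give a Cauchy sequence of
    combinations of the [phi i], and [u] is its limit.  Thus [f] may lie in an
    incomplete space; [u] represents its projection on the closed span, which
    explains the bound on the norm and the last clause. *)
Lemma gram_transfer (I A1 A2 : Type) S1 ip1 S2 ip2 (k : I -> A1 -> C)
    (phi : I -> A2 -> C) :
  pre_hilbert S1 ip1 -> pre_hilbert S2 ip2 -> complete_space S2 ip2 ->
  (forall i, S1 (k i)) -> (forall i, S2 (phi i)) ->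
  (forall i j, ip1 (k i) (k j) = ip2 (phi i) (phi j)) ->
  forall f, S1 f -> exists u, [/\ S2 u,
    forall i, ip2 u (phi i) = ip1 f (k i),
    sqn ip2 u <= sqn ip1 f &
    forall v, S2 v -> (forall i, ip2 v (phi i) = 0) -> ip2 u v = 0].
Proof.
move=> H1 H2 cpl Sk Sphi gram f Sf.
have Sc1 l := lincomb_in H1 Sk l.
have Sc2 l := lincomb_in H2 Sphi l.
have gramE l l' : ip1 (lincomb k l) (lincomb k l') =
    ip2 (lincomb phi l) (lincomb phi l').
  rewrite (ip_lincombl H1 Sk) // (ip_lincombl H2 Sphi) //; apply: eq_bigr => p _.
  rewrite (ip_lincombr H1 Sk) // (ip_lincombr H2 Sphi) //; congr (_ * _).
  by apply: eq_bigr => q _; rewrite gram.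
pose J l := sqn ip1 (f \- lincomb k l).
have J0 l : 0 <= J l by apply: (sqn_ge0 H1); apply: ph_sub H1 _ _ Sf _.
pose E := [set J l | l in [set: seq (C * I)]].
pose d := inf E.
have hE : has_inf E.
  split; first by exists (J [::]), [::].
  by exists 0 => _ [l _ <-].
have dJ l : d <= J l by apply: ge_inf; [exact: hE.2|exists l].
(* near-minimality of [l] makes [f - lincomb k l] nearly orthogonal to the span *)
have var l l' : sqnorm (ip1 (lincomb k l') (f \- lincomb k l)) <=
    sqn ip1 (lincomb k l') * (J l - d).
  apply: quad_disc; first exact: (sqn_ge0 H1).
  move=> a; have := dJ (scale_list (- a) l' ++ l).
  rewrite /J lincomb_lin.
  rewrite (_ : f \- _ = fun z => a * lincomb k l' z + (f \- lincomb k l) z).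
    rewrite (sqn_lin H1) //; last exact: ph_sub H1 _ _ Sf _.
    by rewrite -subr_ge0 addrA.
  by apply/funext => x /=; rewrite mulNr opprD opprK addrCA.
have exl (n : nat) : exists l, J l < d + n.+1%:R^-1.
  have [|_ [l _ <-] h] := @inf_adherent _ E n.+1%:R^-1 _ hE.
    by rewrite invr_gt0.
  by exists l.
have [ln hln] := choice exl.
have {}hln n : J (ln n) - d <= n.+1%:R^-1 by rewrite lerBlDl ltW.
pose un n := lincomb phi (ln n).
have diffE l l' : lincomb phi l \- lincomb phi l' =
    lincomb phi (scale_list (-1) l' ++ l).
  by rewrite lincomb_lin; apply/funext => x /=; rewrite mulN1r addrC.
have diffE1 l l' : lincomb k l \- lincomb k l' =
    lincomb k (scale_list (-1) l' ++ l).
  by rewrite lincomb_lin; apply/funext => x /=; rewrite mulN1r addrC.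
(* the parallelogram law, with the midpoint of the two combinations *)
have par l l' : sqn ip2 (lincomb phi l \- lincomb phi l') <=
    2 * (J l - d) + 2 * (J l' - d).
  have -> : sqn ip2 (lincomb phi l \- lincomb phi l') =
      sqn ip1 (lincomb k l \- lincomb k l').
    by rewrite /sqn diffE diffE1 gramE.
  have := dJ (scale_list (2^-1) l ++ scale_list (2^-1) l').
  rewrite /J lincomb_lin.
  rewrite lincomb_scale (_ : f \- _ =
    fun z => 2^-1 * ((f \- lincomb k l) \+ (f \- lincomb k l')) z); last first.
    by apply/funext => x /=; field.
  have Sd l0 : S1 (f \- lincomb k l0) by exact: (ph_sub H1).
  rewrite (sqn_scale H1); last exact: (ph_add H1).
  have -> : sqnorm (2^-1 : C) = 4^-1.
    by rewrite -[2^-1]/((2%:R : C)^-1) -(rmorph_nat (real_complex R)) -fmorphV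
      /sqnorm !ReImE; field.
  have -> : lincomb k l \- lincomb k l' = (f \- lincomb k l') \- (f \- lincomb k l).
    by apply/funext => x /=; ring.
  have := sqnB H1 (Sd l') (Sd l); have := sqnD H1 (Sd l) (Sd l').
  rewrite (ph_conj H1 (Sd l) (Sd l')) !ReImE.
  lra.
have inv_small (e : R) : 0 < e ->
    exists N, forall n, (N <= n)%N -> n.+1%:R^-1 <= e.
  move=> e0; exists (Num.truncn e^-1) => n Nn.
  rewrite invf_ple ?posrE ?ltr0n //; apply/ltW.
  by apply: (lt_le_trans (truncnS_gt _)); rewrite ler_nat.
have [|u Su ulim] := cpl un (fun n => Sc2 (ln n)).
  move=> e e0; have [|N hN] := inv_small (e / 8); first by rewrite divr_gt0.
  exists N => m n Nm Nn; apply: (le_lt_trans (par _ _)).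
  have := le_trans (hln m) (hN _ Nm); have := le_trans (hln n) (hN _ Nn).
  lra.
have both (e : R) : 0 < e -> exists l,
    [/\ sqn ip2 (lincomb phi l \- u) <= e & J l - d <= e].
  move=> e0; have [N hN] := ulim _ e0; have [N' hN'] := inv_small _ e0.
  exists (ln (maxn N N')); split; first by apply/ltW/hN/leq_maxl.
  by apply: (le_trans (hln _)); apply/hN'/leq_maxr.
have val i : ip2 u (phi i) = ip1 f (k i).
  apply/eqP; rewrite -subr_eq0; apply/eqP/sqnorm_eq0.
  apply: (@le0_eps_scaled _ (2 * sqn ip2 (phi i) + 2 * sqn ip1 (k i))).
    by rewrite addr_ge0 // mulr_ge0 // ?(sqn_ge0 H1) ?(sqn_ge0 H2).
  move=> e e0; have [l [l1 l2]] := both e e0.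
  have e1 : ip1 (lincomb k l) (k i) = ip2 (lincomb phi l) (phi i).
    rewrite (ip_lincombl H1 Sk) // (ip_lincombl H2 Sphi) //.
    by apply: eq_bigr => p _; rewrite gram.
  rewrite (_ : _ - _ = - ip2 (lincomb phi l \- u) (phi i) +
    - ip1 (f \- lincomb k l) (k i)); last first.
    rewrite (ipBl H1) // (ipBl H2) // e1; ring.
  apply: (le_trans (sqnormD_le _ _)).
  rewrite !sqnormN [leRHS]mulrDl -2!mulrA; apply: lerD; rewrite ler_wpM2l //.
    apply: le_trans (cauchy_schwarz H2 _ _) _ => //; first exact: (ph_sub H2).
    by rewrite mulrC ler_wpM2l // (sqn_ge0 H2).
  rewrite (ph_conj H1 (Sk i) (ph_sub H1 Sf (Sc1 l))) sqnorm_conjc.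
  have kE : k i = lincomb k [:: (1, i)].
    by apply/funext => x; rewrite /lincomb big_cons big_nil mul1r addr0.
  rewrite kE; apply: (le_trans (var l _)).
  by rewrite ler_wpM2l // (sqn_ge0 H1).
exists u; split => //.
- rewrite -subr_le0; apply: (@le0_eps_scaled _ 1) => // e e0; rewrite mul1r.
  have [l [l1 l2]] := both e e0.
  apply: le_trans l1; rewrite (sqnC H2) // (sqnB H2) //.
  have -> : ip2 u (lincomb phi l) = ip1 f (lincomb k l).
    rewrite (ip_lincombr H1 Sk) // (ip_lincombr H2 Sphi) //.
    by apply: eq_bigr => p _; rewrite val.
  have -> : sqn ip2 (lincomb phi l) = sqn ip1 (lincomb k l) by rewrite /sqn gramE.
  have := J0 l; rewrite /J (sqnB H1) //; lra.
- move=> v Sv v0; apply: sqnorm_eq0.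
  apply: (@le0_eps_scaled _ (sqn ip2 v)); first exact: (sqn_ge0 H2).
  move=> e e0; have [l [l1 l2]] := both e e0.
  have -> : ip2 u v = - ip2 (lincomb phi l \- u) v.
    rewrite (ipBl H2) // (ip_lincombl H2 Sphi) // big1 ?sub0r ?opprK //.
    by move=> p _; rewrite (ph_conj H2 Sv (Sphi _)) v0 conjc0 mulr0.
  rewrite sqnormN.
  apply: le_trans (cauchy_schwarz H2 _ _) _ => //; first exact: (ph_sub H2).
  by rewrite mulrC ler_wpM2l // (sqn_ge0 H2).
Qed.

End PreHilbert.

(** * Reproducing kernel Hilbert spaces as images of Hilbert spaces *)

Section Rkhs.
Context {R : realType}.
Local Notation C := R[i].

Lemma hnorm_lt (ip : (C -> C) -> (C -> C) -> C) f (e : R) : 0 < e ->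
  0 <= sqn ip f -> (hnorm ip f < e) = (sqn ip f < e ^+ 2).
Proof.
move=> e0 f0; rewrite /hnorm -/(sqn ip f).
by rewrite -[in LHS](gtr0_norm e0) -sqrtr_sqr ltr_sqrt // exprn_gt0.
Qed.

(** Completeness is stated with norms on one side and with squared norms on the
    other one; squares avoid the triangle inequality for the norm. *)
Lemma hilbert_function_spaceP (X : set C) (H : set (C -> C)) ip :
  hilbert_function_space X H ip <->
  [/\ pre_hilbert H ip, complete_space H ip,
      (forall f, H f -> restr X f = f) &
      forall f, H f -> ip f f = 0 -> f = cst 0].
Proof.
split=> [h|[ph cpl res def]].
  have ph : pre_hilbert H ip.
    by split; [exact: hfs_zero h|exact: hfs_linear h|exact: hfs_ip_linear h|
      exact: hfs_ip_conj h|exact: hfs_ip_ge0 h].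
  split => //; [|exact: hfs_restr h|exact: hfs_ip_eq0 h].
  move=> u Hu cau; have [e e0|f Hf lim] := hfs_complete h Hu.
    have [N hN] := cau _ (exprn_gt0 2 e0); exists N => m n Nm Nn.
    by rewrite hnorm_lt ?hN // (sqn_ge0 ph) //; exact: (ph_sub ph).
  exists f => // e e0.
  have [] := (cvgrPdist_lt _ _).1 lim (Num.sqrt e).
    by rewrite sqrtr_gt0.
  move=> N _ hN; exists N => n Nn; have := hN n Nn.
  rewrite /= sub0r normrN ger0_norm ?sqrtr_ge0 //.
  have Sd := ph_sub ph (Hu n) Hf; have s0 := sqn_ge0 ph Sd.
  by rewrite hnorm_lt ?sqrtr_gt0 ?sqr_sqrtr // ltW.
split => //; [exact: ph_zero ph|exact: ph_linear ph|exact: ph_ipL ph|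
  exact: ph_conj ph|exact: ph_ge0 ph|].
move=> u Hu cau; have [e e0|f Hf lim] := cpl u Hu.
  have [|N hN] := cau (Num.sqrt e); first by rewrite sqrtr_gt0.
  exists N => m n Nm Nn; have := hN m n Nm Nn.
  have Sd := ph_sub ph (Hu m) (Hu n); have s0 := sqn_ge0 ph Sd.
  by rewrite hnorm_lt ?sqrtr_gt0 ?sqr_sqrtr // ltW.
exists f => //; apply/cvgrPdist_lt => e e0.
have [N hN] := lim _ (exprn_gt0 2 e0).
exists N => // n Nn; rewrite /= sub0r normrN ger0_norm ?sqrtr_ge0 //.
by rewrite hnorm_lt ?hN // (sqn_ge0 ph) //; exact: (ph_sub ph).
Qed.

Variables (A : Type) (S : set (A -> C)) (ip : (A -> C) -> (A -> C) -> C).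
Hypotheses (ph : pre_hilbert S ip) (cpl : complete_space S ip).
Variables (X : set C) (phi : C -> A -> C) (K : C -> C -> C).
Hypothesis Sphi : forall z, X z -> S (phi z).
Hypothesis KE : forall z w, X z -> X w -> K z w = ip (phi w) (phi z).

Lemma restrE (f : C -> C) z : X z -> restr X f z = f z.
Proof. by move=> Xz; rewrite /restr /patch mem_set. Qed.

Lemma eq_restr (f g : C -> C) : (forall z, X z -> f z = g z) ->
  restr X f = restr X g.
Proof.
move=> fg; apply/funext => z; rewrite /restr /patch.
by case: ifPn => // /set_mem /fg.
Qed.

(** [gram_transfer] from the function space to [S]: by the reproducing property,
    the inner products of [f] with the kernel functions are its values. *)
Lemma rkhs_sub (H : set (C -> C)) ip' : rkhs X K H ip' -> forall f, H f ->
  exists u, [/\ S u, forall z, X z -> f z = ip u (phi z) &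
    sqn ip u <= sqn ip' f].
Proof.
case=> /hilbert_function_spaceP [ph' _ _ _] ker rep f Hf.
pose I := {z | X z}.
have [|||u [Su uE le _]] := @gram_transfer R I C A H ip' S ip
    (fun i => restr X (K ^~ (sval i))) (fun i => phi (sval i)) ph' ph cpl _ _ _ f Hf.
- by move=> i; apply: ker; exact: svalP.
- by move=> i; apply: Sphi; exact: svalP.
- move=> [z Xz] [w Xw] /=; rewrite -rep //; last exact: ker.
  by rewrite restrE // KE.
exists u; split => // z Xz.
by rewrite rep // (uE (exist _ z Xz)).
Qed.

(** [gram_transfer] in the other direction, which uses the completeness of the
    reproducing kernel space. *)
Lemma rkhs_sup (H : set (C -> C)) ip' : rkhs X K H ip' -> forall u, S u ->
  exists f, [/\ H f, forall z, X z -> f z = ip u (phi z) &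
    sqn ip' f <= sqn ip u].
Proof.
case=> /hilbert_function_spaceP [ph' cpl' _ _] ker rep u Su.
pose I := {z | X z}.
have [|||f [Hf fE le _]] := @gram_transfer R I A C S ip H ip'
    (fun i => phi (sval i)) (fun i => restr X (K ^~ (sval i))) ph ph' cpl' _ _ _ u Su.
- by move=> i; apply: Sphi; exact: svalP.
- by move=> i; apply: ker; exact: svalP.
- move=> [z Xz] [w Xw] /=; rewrite -rep //; last exact: ker.
  by rewrite restrE // KE.
exists f; split => // z Xz.
by rewrite rep // (fE (exist _ z Xz)).
Qed.

(** The inner product is carried over from [S] by choosing, for each function, a
    representing vector orthogonal to the vectors that represent 0.
    [gram_transfer] from [S] to itself provides it, as the projection on the closed
    span of the [phi z]. *)
Lemma rkhs_exists : exists H ip', rkhs X K H ip'.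
Proof.
pose val u : C -> C := restr X (fun z => ip u (phi z)).
pose N := [set v | S v /\ forall z, X z -> ip v (phi z) = 0].
pose H := [set val u | u in S].
have : forall f, exists p, H f ->
    [/\ S p, val p = f & forall v, N v -> ip p v = 0].
  move=> f; have [[u Su <-]|nH] := pselect (H f); last by exists (cst 0).
  have [|||p [Sp pE _ orth]] := @gram_transfer R {z | X z} A A S ip S ip
    (fun i => phi (sval i)) (fun i => phi (sval i)) ph ph cpl _ _ _ u Su => //.
  - by move=> i; apply: Sphi; exact: svalP.
  - by move=> i; apply: Sphi; exact: svalP.
  exists p => _; split => //.
    by apply: eq_restr => z Xz; rewrite (pE (exist _ z Xz)).
  by move=> v [Sv v0]; apply: orth => // -[z Xz]; exact: v0.
move=> /choice [p pP].
have valE u z : X z -> val u z = ip u (phi z) by move=> Xz; exact: restrE.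
(* [p f] represents [f] as soon as it has the right values, up to a null vector *)
have uniq u f : S u -> H f -> (forall v, N v -> ip u v = 0) ->
    val u = f -> sqn ip (u \- p f) = 0.
  move=> Su Hf uN uf; have [Sp pf pN] := pP f Hf.
  have Nd : N (u \- p f).
    split; first exact: (ph_sub ph).
    move=> z Xz; rewrite (ipBl ph) //; last exact: Sphi.
    by rewrite -!valE // uf pf subrr.
  rewrite /sqn (ipBl ph) //; last exact: (ph_sub ph).
  by rewrite uN // pN // subrr.
have uniqE u f v : S u -> H f -> (forall v, N v -> ip u v = 0) ->
    val u = f -> S v -> ip (p f) v = ip u v.
  move=> Su Hf uN uf Sv; have [Sp pf pN] := pP f Hf.
  apply/esym/eqP; rewrite -subr_eq0 -(ipBl ph) //; apply/eqP.
  by apply: (ip_null ph) => //; [exact: (ph_sub ph)|exact: uniq].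
have lincomb_orth a f g : H f -> H g ->
    [/\ S (fun x => a * p f x + p g x),
       val (fun x => a * p f x + p g x) = fun z => a * f z + g z &
       forall v, N v -> ip (fun x => a * p f x + p g x) v = 0].
  move=> Hf Hg; have [Sf fE fN] := pP f Hf; have [Sg gE gN] := pP g Hg.
  split; first exact: (ph_linear ph).
    apply/funext => z; have [Xz|nXz] := pselect (X z).
      rewrite valE // (ph_ipL ph) //; last exact: Sphi.
      by rewrite -!valE // fE gE.
    rewrite -{2}fE -{2}gE /val /restr /patch memNset //= mulr0 addr0 //.
  move=> v Nv; rewrite (ph_ipL ph) //; last by case: Nv.
  by rewrite fN // gN // mulr0 addr0.
have Hlin a f g : H f -> H g -> H (fun z => a * f z + g z).
  move=> Hf Hg; have [Sfg <- _] := lincomb_orth a f g Hf Hg.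
  by exists (fun x => a * p f x + p g x).
pose ip' f g := ip (p f) (p g).
(* linearity of [p] holds only up to null vectors, which no inner product sees *)
have ipL a f g h : H f -> H g -> S h ->
    ip (p (fun z => a * f z + g z)) h = a * ip (p f) h + ip (p g) h.
  move=> Hf Hg Sh; have [Sfg E orth] := lincomb_orth a f g Hf Hg.
  rewrite (uniqE _ _ _ Sfg) //; last exact: Hlin.
  by rewrite (ph_ipL ph) //; case: (pP f Hf); case: (pP g Hg).
have Sp f : H f -> S (p f) by move=> /pP[].
have ph' : pre_hilbert H ip'.
  split.
  - exists (cst 0); first exact: ph_zero ph.
    apply/funext => z; rewrite /val /restr /patch; case: ifPn => // /set_mem Xz.
    by rewrite (ip0l ph) //; exact: Sphi.
  - exact: Hlin.
  - by move=> a f g h Hf Hg Hh; apply: ipL => //; exact: Sp.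
  - by move=> f g Hf Hg; apply: (ph_conj ph); exact: Sp.
  - by move=> f Hf; apply: (ph_ge0 ph); exact: Sp.
have sqnBE f g : H f -> H g -> sqn ip' (f \- g) = sqn ip (p f \- p g).
  move=> Hf Hg; rewrite (sqnB ph') // (sqnB ph) //; exact: Sp.
exists H, ip'; split.
- apply/hilbert_function_spaceP; split => //.
  + move=> u Hu cau.
    have [||w Sw lim] := @cpl (p \o u).
    * by move=> n; exact: Sp.
    * move=> e e0; have [M hM] := cau e e0; exists M => m n Mm Mn.
      by rewrite -sqnBE //; exact: hM.
    have Hw : H (val w) by exists w.
    have wN v : N v -> ip w v = 0.
      move=> Nv; have Sv := Nv.1.
      apply: sqnorm_eq0; apply: (@le0_eps_scaled _ _ (sqn ip v)).
        exact: (sqn_ge0 ph).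
      move=> e e0; have [M hM] := lim e e0.
      have -> : ip w v = - ip (p (u M) \- w) v.
        rewrite (ipBl ph) //; last exact: Sp.
        by case: (pP (u M) (Hu M)) => _ _ ->; rewrite // sub0r opprK.
      rewrite sqnormN; apply: le_trans (cauchy_schwarz ph _ _) _ => //.
        by apply: (ph_sub ph) => //; exact: Sp.
      by rewrite mulrC ler_wpM2l ?(sqn_ge0 ph) //; exact/ltW/hM.
    exists (val w) => // e e0; have [M hM] := lim (e / 4) (divr_gt0 e0 (ltr0Sn _ _)).
    exists M => n Mn; rewrite sqnBE //.
    apply: le_lt_trans (sqn_tri ph (Sp _ (Hu n)) (Sp _ Hw) Sw) _.
    rewrite (uniq w (val w)) // mulr0 addr0; have := hM _ Mn; lra.
  + move=> f [u _ <-]; rewrite /val; apply: eq_restr => z Xz.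
    by rewrite restrE.
  + move=> f Hf; rewrite /ip' => f0; have [Sf <- _] := pP f Hf.
    apply/funext => z; rewrite /val /restr /patch; case: ifPn => // /set_mem Xz.
    by apply: (ip_null ph) => //; [exact: Sphi|rewrite /sqn f0].
- move=> w Xw; exists (phi w); first exact: Sphi.
  by apply: eq_restr => z Xz; rewrite KE.
- move=> f w Hf Xw; have [Sf fE fN] := pP f Hf.
  have kE : val (phi w) = restr X (K ^~ w).
    by apply: eq_restr => z Xz; rewrite KE.
  have Hk : H (restr X (K ^~ w)) by exists (phi w) => //; exact: Sphi.
  have Sw : S (phi w) by exact: Sphi.
  have wN v : N v -> ip (phi w) v = 0.
    by move=> [Sv v0]; rewrite (ph_conj ph Sv Sw) v0 // conjc0.
  rewrite /ip' (ph_conj ph (Sp _ Hk) Sf) (uniqE (phi w)) // -(ph_conj ph) //.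
  by rewrite -{1}fE valE.
Qed.

End Rkhs.

(** * Unordered sums of real families *)

Section RealSums.
Context {R : realType} {I : countType}.
Implicit Types (a b p q B : I -> R).

Definition esumR a : \bar R := \esum_(i in [set: I]) (a i)%:E.
Definition nnsum a : R := fine (esumR a).
Definition rsummable a : Prop := (esumR (fun i => `|a i|%R) < +oo)%E.

(** Enumerating the index type turns an unordered sum into a series, to which
    monotone convergence applies; the indices outside the range of the enumeration
    contribute 0. *)
Lemma esumR_nneseries (a : I -> \bar R) : (forall i, 0 <= a i)%E ->
  (\esum_(i in [set: I]) a i = \sum_(0 <= n <oo) oapp a 0 (@pickle_inv I n))%E.
Proof.
move=> a0; rewrite nneseries_esumT; last by move=> n; case: pickle_inv => /=.
rewrite (esumID (range (@pickle I))); last by move=> n _; case: pickle_inv => /=.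
rewrite [X in (_ + X)%E]esum1 ?adde0; last first.
  move=> n [_ nr]; case E : (pickle_inv n) => [i|] //=.
  by case: nr; exists i => //; have := @pickle_invK I n; rewrite E.
rewrite setTI esum_image; last by move=> x y _ _; exact: (pcan_inj pickleK).
by apply: eq_esum => i _; rewrite /= pickleK_inv.
Qed.

Lemma esumR_ge0 p : (forall i, 0 <= p i) -> (0 <= esumR p)%E.
Proof. by move=> p0; apply: esum_ge0 => i _; rewrite lee_fin. Qed.

Lemma nnsum_ge0 p : (forall i, 0 <= p i) -> 0 <= nnsum p.
Proof. by move=> p0; apply/fine_ge0/esumR_ge0. Qed.

Lemma summ_le B a : rsummable B -> (forall i, `|a i| <= B i) -> rsummable a.
Proof.
move=> sB aB; apply: le_lt_trans sB; apply: le_esum => i _.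
by rewrite lee_fin (le_trans (aB i)) // ler_norm.
Qed.

Lemma summ_abs a : rsummable a -> rsummable (fun i => `|a i|).
Proof.
move=> sa; rewrite /rsummable (_ : esumR _ = esumR (fun i => `|a i|)) //.
by congr esumR; apply/funext => i; rewrite normr_id.
Qed.

Lemma summ_nneg p : rsummable p -> (forall i, 0 <= p i) -> (nnsum p)%:E = esumR p.
Proof.
move=> sp p0; rewrite /nnsum fineK // ge0_fin_numE ?esumR_ge0 //.
apply: le_lt_trans sp; apply: le_esum => i _.
by rewrite lee_fin ler_norm.
Qed.

Lemma le_nnsum p q : rsummable q -> (forall i, 0 <= p i <= q i) -> nnsum p <= nnsum q.
Proof.
move=> sq pq; have p0 i : 0 <= p i by case/andP: (pq i).
have pq' i : p i <= q i by case/andP: (pq i).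
have sp : rsummable p by apply: (summ_le sq) => i; rewrite ger0_norm.
rewrite -lee_fin !summ_nneg //; last by move=> i; exact: le_trans (pq' i).
by apply: le_esum => i _; rewrite lee_fin.
Qed.

Lemma esumRD p q : rsummable p -> rsummable q -> (forall i, 0 <= p i) ->
  (forall i, 0 <= q i) ->
  esumR (fun i => p i + q i) = (nnsum p + nnsum q)%:E.
Proof.
move=> sp sq p0 q0; rewrite EFinD !summ_nneg // -esumD //.
  by move=> i _; rewrite lee_fin.
by move=> i _; rewrite lee_fin.
Qed.

Lemma esumRZ (c : R) (p : I -> \bar R) : 0 <= c -> (forall i, 0 <= p i)%E ->
  (\esum_(i in [set: I]) (c%:E * p i) = c%:E * \esum_(i in [set: I]) p i)%E.
Proof.
move=> c0 p0; rewrite !esumR_nneseries //; last first.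
  by move=> i; rewrite mule_ge0.
rewrite -nneseriesZl; last by move=> n _; case: pickle_inv => /=.
by apply: eq_eseriesr => n _; case: pickle_inv => //=; rewrite mule0.
Qed.

Lemma nnsumD p q : rsummable p -> rsummable q -> (forall i, 0 <= p i) ->
  (forall i, 0 <= q i) -> nnsum (fun i => p i + q i) = nnsum p + nnsum q.
Proof. by move=> *; rewrite [LHS]/nnsum esumRD. Qed.

Lemma esumRZr c p : rsummable p -> 0 <= c -> (forall i, 0 <= p i) ->
  esumR (fun i => c * p i) = (c * nnsum p)%:E.
Proof.
move=> sp c0 p0; rewrite EFinM summ_nneg // -esumRZ //.
Qed.

Lemma nnsumZ c p : rsummable p -> 0 <= c -> (forall i, 0 <= p i) ->
  nnsum (fun i => c * p i) = c * nnsum p.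
Proof. by move=> *; rewrite [LHS]/nnsum esumRZr. Qed.

Lemma summD a b : rsummable a -> rsummable b -> rsummable (fun i => a i + b i).
Proof.
move=> sa sb; apply: (@summ_le (fun i => `|a i| + `|b i|)); last first.
  by move=> i; exact: ler_normD.
have sa' := summ_abs sa; have sb' := summ_abs sb.
rewrite /rsummable [esumR _](_ : _ = esumR (fun i => `|a i| + `|b i|)).
  by rewrite esumRD // ltry.
by congr esumR; apply/funext => i; rewrite ger0_norm // addr_ge0.
Qed.

Lemma summZ c a : rsummable a -> rsummable (fun i => c * a i).
Proof.
move=> sa; rewrite /rsummable [esumR _](_ : _ = esumR (fun i => `|c| * `|a i|)).
  by rewrite esumRZr ?ltry //; exact: summ_abs.
by congr esumR; apply/funext => i; rewrite normrM.
Qed.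

(** The positive and negative parts used in the definition of [rsum] may be
    replaced by any decomposition into summable nonnegative families. *)
Lemma rsumB p q : rsummable p -> rsummable q -> (forall i, 0 <= p i) ->
  (forall i, 0 <= q i) -> rsum (fun i => p i - q i) = nnsum p - nnsum q.
Proof.
move=> sp sq p0 q0.
have := @esumB R I [set: I] (EFin \o p) (EFin \o q) sp sq.
rewrite /rsum (_ : EFin \o (fun i => p i - q i) =
  ((EFin \o p) \- (EFin \o q))%E); last by apply/funext => i.
move=> -> //; try by move=> i _; rewrite /= lee_fin.
by rewrite -[esum _ _]summ_nneg // -[X in (_ - X)%E]summ_nneg.
Qed.

Definition ppart a i := Num.max (a i) 0.
Definition npart a i := Num.max (- a i) 0.
Lemma ppart_ge0 a i : 0 <= ppart a i. Proof. by rewrite le_max lexx orbT. Qed.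
Lemma npart_ge0 a i : 0 <= npart a i. Proof. by rewrite le_max lexx orbT. Qed.
Lemma ppartE a : a = fun i => ppart a i - npart a i.
Proof.
apply/funext => i; rewrite /ppart /npart.
have [h|/ltW h] := leP (a i) 0.
  by rewrite max_l ?oppr_ge0 // sub0r opprK.
by rewrite max_r ?subr0 // oppr_le0.
Qed.
Lemma ppart_le a i : `|ppart a i| <= `|a i|.
Proof.
rewrite ger0_norm ?ppart_ge0 // ge_max normr_ge0 andbT; exact: ler_norm.
Qed.
Lemma npart_le a i : `|npart a i| <= `|a i|.
Proof.
rewrite ger0_norm ?npart_ge0 // ge_max normr_ge0 andbT -normrN; exact: ler_norm.
Qed.
Lemma summ_ppart a : rsummable a -> rsummable (ppart a).
Proof. by move=> sa; apply: (summ_le (summ_abs sa)) => i; exact: ppart_le. Qed.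
Lemma summ_npart a : rsummable a -> rsummable (npart a).
Proof. by move=> sa; apply: (summ_le (summ_abs sa)) => i; exact: npart_le. Qed.

Lemma rsum_parts a : rsummable a -> rsum a = nnsum (ppart a) - nnsum (npart a).
Proof.
move=> sa; rewrite {1}[a]ppartE rsumB //.
- exact: summ_ppart.
- exact: summ_npart.
- exact: ppart_ge0.
- exact: npart_ge0.
Qed.

Lemma rsumD a b : rsummable a -> rsummable b ->
  rsum (fun i => a i + b i) = rsum a + rsum b.
Proof.
move=> sa sb; rewrite (rsum_parts sa) (rsum_parts sb).
have pa := summ_ppart sa; have na := summ_npart sa.
have pb := summ_ppart sb; have nb := summ_npart sb.
rewrite (_ : (fun i => _) = fun i => (ppart a i + ppart b i) -
    (npart a i + npart b i)); last first.
  by apply/funext => i; rewrite {1}[a]ppartE {1}[b]ppartE; ring.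
rewrite rsumB; first 1 last.
- exact: summD.
- exact: summD.
- by move=> i; rewrite addr_ge0 ?ppart_ge0.
- by move=> i; rewrite addr_ge0 ?npart_ge0.
have pg := ppart_ge0; have ng := npart_ge0.
rewrite !nnsumD //; ring.
Qed.

Lemma rsumN a : rsummable a -> rsum (fun i => - a i) = - rsum a.
Proof.
move=> sa; rewrite (rsum_parts sa) opprB -rsumB.
- by congr rsum; apply/funext => i; rewrite {1}[a]ppartE opprB.
- exact: summ_npart.
- exact: summ_ppart.
- exact: npart_ge0.
- exact: ppart_ge0.
Qed.

Lemma rsumZ c a : rsummable a -> rsum (fun i => c * a i) = c * rsum a.
Proof.
wlog c0 : c a / 0 <= c => [hw|] sa.
  have [/hw -> //|/ltW c0] := leP 0 c.
  have sa' : rsummable (fun i => - a i)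
    by apply: (summ_le (summ_abs sa)) => i; rewrite normrN.
  rewrite -[RHS]mulrNN -rsumN // -hw ?oppr_ge0 //.
  by congr rsum; apply/funext => i; rewrite mulrNN.
have pa := summ_ppart sa; have na := summ_npart sa.
have pg := ppart_ge0; have ng := npart_ge0.
rewrite (rsum_parts sa) (_ : (fun i => _) = fun i => c * ppart a i -
    c * npart a i); last first.
  by apply/funext => i; rewrite {1}[a]ppartE; ring.
rewrite rsumB; first 1 last.
- exact: summZ.
- exact: summZ.
- by move=> i; rewrite mulr_ge0 ?ppart_ge0.
- by move=> i; rewrite mulr_ge0 ?npart_ge0.
rewrite !nnsumZ //; ring.
Qed.

Lemma rsum_le B a : rsummable B -> (forall i, `|a i| <= B i) -> `|rsum a| <= nnsum B.
Proof.
move=> sB aB; have sa := summ_le sB aB.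
rewrite (rsum_parts sa).
have h1 : 0 <= nnsum (ppart a) <= nnsum B.
  rewrite nnsum_ge0; last exact: ppart_ge0.
  apply: le_nnsum => // i; rewrite ppart_ge0 /=.
  by rewrite -[leLHS]ger0_norm ?ppart_ge0 // (le_trans (ppart_le _ _)).
have h2 : 0 <= nnsum (npart a) <= nnsum B.
  rewrite nnsum_ge0; last exact: npart_ge0.
  apply: le_nnsum => // i; rewrite npart_ge0 /=.
  by rewrite -[leLHS]ger0_norm ?npart_ge0 // (le_trans (npart_le _ _)).
rewrite ler_norml; lra.
Qed.

Lemma rsum_reindex (e : I -> I) a : bijective e ->
  rsum (fun i => a (e i)) = rsum a.
Proof.
move=> be; rewrite /rsum.
have sb : set_bij [set: I] [set: I] e by rewrite setTT_bijective.
rewrite (@reindex_esum _ _ _ _ _ e (EFin \o a)^\+%E sb).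
rewrite (@reindex_esum _ _ _ _ _ e (EFin \o a)^\-%E sb).
by congr (fine (_ - _)%E); apply: eq_esum => i _; rewrite /= ?funeposE ?funenegE.
Qed.

Section Integral.
Context d (T : measurableType d) (mu : {measure set T -> \bar R}).
Variables (D : set T) (f : I -> T -> R) (B : I -> R).
Hypotheses (mD : measurable D) (fD : (mu D < +oo)%E) (sB : rsummable B).
Hypothesis mf : forall i, measurable_fun D (f i).

Lemma nnsum_measurable_integral : (forall i t, D t -> 0 <= f i t <= B i) ->
  measurable_fun D (fun t => nnsum (f ^~ t)) /\
  \int[mu]_(t in D) nnsum (f ^~ t) = nnsum (fun i => \int[mu]_(t in D) f i t).
Proof.
move=> fB.
have f0 i t : D t -> 0 <= f i t by move=> Dt; case/andP: (fB i t Dt).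
have B0 t : D t -> forall i, 0 <= B i.
  by move=> Dt i; case/andP: (fB i t Dt) => a b; exact: le_trans a b.
pose g n t : \bar R := oapp (fun i => (f i t)%:E) 0%E (@pickle_inv I n).
have gE t : D t -> (nnsum (f ^~ t))%:E = (\sum_(0 <= n <oo) g n t)%E.
  move=> Dt; rewrite summ_nneg ?/esumR ?esumR_nneseries //.
  - by move=> i; rewrite lee_fin f0.
  - by apply: (summ_le sB) => i; case/andP: (fB i t Dt) => h1 h2;
      rewrite ger0_norm.
  - by move=> i; exact: f0.
have mg n : measurable_fun D (g n).
  rewrite /g; case: pickle_inv => [i|] /=; last exact: measurable_cst.
  exact/measurable_EFinP.
have g0 n t : D t -> (0 <= g n t)%E.
  by move=> Dt; rewrite /g; case: pickle_inv => [i|] //=; rewrite lee_fin f0.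
split.
  apply/measurable_EFinP.
  apply: (eq_measurable_fun (fun t => \sum_(0 <= n <oo) g n t)%E).
    by move=> t /set_mem Dt /=; rewrite gE.
  have := @ge0_emeasurable_sum _ _ R D g xpredT.
  by apply => // k t Dt _; exact: g0.
rewrite /Rintegral (eq_integral (fun t => \sum_(0 <= n <oo) g n t)%E); last first.
  by move=> t /set_mem Dt; rewrite gE.
rewrite integral_nneseries // /nnsum; congr fine.
rewrite /esumR esumR_nneseries; last first.
  by move=> i; rewrite lee_fin; apply: Rintegral_ge0 => t Dt; exact: f0.
apply: eq_eseriesr => n _; rewrite /g; case: pickle_inv => [i|] /=; last first.
  by rewrite integral0.
rewrite fineK //; apply: integrable_fin_num => //.
apply: measurable_bounded_integrable => //.
exists (B i); split; first exact: num_real.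
move=> x Bx t /fB -/(_ i) /andP[h1 h2]; rewrite /= ger0_norm //.
by rewrite (le_trans h2) // ltW.
Qed.
End Integral.

(** Exchange of sum and integral under domination, by monotone convergence for the
    positive and the negative parts. *)
Lemma rsum_measurable_integral d (T : measurableType d)
    (mu : {measure set T -> \bar R}) (D : set T) (f : I -> T -> R) (B : I -> R) :
  measurable D -> (mu D < +oo)%E -> rsummable B -> (forall i, 0 <= B i) ->
  (forall i, measurable_fun D (f i)) ->
  (forall i t, D t -> `|f i t| <= B i) ->
  measurable_fun D (fun t => rsum (f ^~ t)) /\
  \int[mu]_(t in D) rsum (f ^~ t) = rsum (fun i => \int[mu]_(t in D) f i t).
Proof.
move=> mD fD sB B0 mf fB.
pose p i t := ppart (f ^~ t) i; pose q i t := npart (f ^~ t) i.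
have mp i : measurable_fun D (p i).
  exact: measurable_maxr.
have mq i : measurable_fun D (q i).
  by apply: measurable_maxr => //; exact: measurableT_comp.
have pB i t : D t -> 0 <= p i t <= B i.
  move=> Dt; rewrite ppart_ge0 /=; apply: le_trans (fB i t Dt).
  exact: le_trans (ler_norm _) (ppart_le _ _).
have qB i t : D t -> 0 <= q i t <= B i.
  move=> Dt; rewrite npart_ge0 /=; apply: le_trans (fB i t Dt).
  exact: le_trans (ler_norm _) (npart_le _ _).
have [mP iP] := nnsum_measurable_integral mD fD sB mp pB.
have [mQ iQ] := nnsum_measurable_integral mD fD sB mq qB.
have E t : D t -> rsum (f ^~ t) = nnsum (p ^~ t) - nnsum (q ^~ t).
  move=> Dt; rewrite rsum_parts //; apply: (summ_le sB) => i; exact: fB.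
have bint (g : T -> R) (b : R) : measurable_fun D g ->
    (forall t, D t -> 0 <= g t <= b) -> mu.-integrable D (EFin \o g).
  move=> mg gb; apply: measurable_bounded_integrable => //.
  exists b; split; first exact: num_real.
  move=> x bx t /gb /andP[h1 h2]; rewrite /= ger0_norm //.
  by rewrite (le_trans h2) // ltW.
have nle (r : I -> T -> R) : (forall i t, D t -> 0 <= r i t <= B i) -> forall t, D t ->
    0 <= nnsum (r ^~ t) <= nnsum B.
  move=> rB t Dt; rewrite nnsum_ge0 /=.
    by apply: le_nnsum => // i; exact: rB.
  by move=> i; case/andP: (rB i t Dt).
split.
  apply: (eq_measurable_fun (fun t => nnsum (p ^~ t) - nnsum (q ^~ t))).
    by move=> t /set_mem Dt; rewrite E.
  exact: measurable_funB.
rewrite (@eq_Rintegral _ _ _ mu D (fun t => nnsum (p ^~ t) - nnsum (q ^~ t)));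
  last by move=> t /set_mem Dt; rewrite E.
rewrite RintegralB //; [|exact: bint (nle _ pB)|exact: bint (nle _ qB)].
have ibound (r : I -> T -> R) : (forall i, measurable_fun D (r i)) ->
    (forall i t, D t -> 0 <= r i t <= B i) ->
    rsummable (fun i => \int[mu]_(t in D) r i t).
  move=> mr rB; apply: (@summ_le (fun i => fine (mu D) * B i)).
    exact: summZ.
  move=> i; rewrite ger0_norm; last first.
    by apply: Rintegral_ge0 => t Dt; case/andP: (rB i t Dt).
  rewrite mulrC -Rintegral_cst //; apply: le_Rintegral => //.
  - exact: bint (rB i).
  - by apply: (bint _ (B i)) => // t Dt; rewrite B0 lexx.
  - by move=> t Dt; case/andP: (rB i t Dt).
rewrite iP iQ -rsumB; first 1 last.
- exact: ibound.
- exact: ibound.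
- by move=> i; apply: Rintegral_ge0 => t Dt; case/andP: (pB i t Dt).
- by move=> i; apply: Rintegral_ge0 => t Dt; case/andP: (qB i t Dt).
congr rsum; apply/funext => i; rewrite -RintegralB //.
- by apply: eq_Rintegral => t _; have /(congr1 (@^~ i)) := ppartE (f ^~ t).
- exact: bint (pB i).
- exact: bint (qB i).
Qed.

End RealSums.

(** * Sums over products *)

Section ProductSums.
Context {R : realType} {I J : countType}.
Implicit Types (a p : I -> R) (b q : J -> R).

Definition pairfam a b (ij : I * J) : R := a ij.1 * b ij.2.

Lemma esumR_pair p q : rsummable p -> rsummable q -> (forall i, 0 <= p i) ->
  (forall j, 0 <= q j) -> esumR (pairfam p q) = (nnsum p * nnsum q)%:E.
Proof.
move=> sp sq p0 q0; rewrite mulrC EFinM (summ_nneg sp) // /esumR -esumRZ ?nnsum_ge0 //.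
rewrite -[setT in LHS](_ : [set: I] `*`` (fun=> [set: J]) = _); last first.
  by apply/seteqP; split.
have <- := @esum_esum R I J setT (fun=> setT) (fun i j => (p i * q j)%:E);
  last by move=> i j _ _; rewrite lee_fin mulr_ge0.
by apply: eq_esum => i _; rewrite -EFinM mulrC -esumRZr.
Qed.

Lemma nnsum_pair p q : rsummable p -> rsummable q -> (forall i, 0 <= p i) ->
  (forall j, 0 <= q j) -> nnsum (pairfam p q) = nnsum p * nnsum q.
Proof. by move=> *; rewrite [LHS]/nnsum esumR_pair. Qed.

Lemma summ_pair a b : rsummable a -> rsummable b -> rsummable (pairfam a b).
Proof.
move=> sa sb; rewrite /rsummable.
rewrite (_ : esumR _ =
    esumR (pairfam (fun i => `|a i|) (fun j => `|b j|))); last first.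
  by congr esumR; apply/funext => ij; rewrite /pairfam normrM.
by rewrite esumR_pair ?ltry //; exact: summ_abs.
Qed.

(** Both factors are split into positive and negative parts, since the sum over
    pairs is an iterated sum for nonnegative families. *)
Lemma rsum_pair a b : rsummable a -> rsummable b ->
  rsum (pairfam a b) = rsum a * rsum b.
Proof.
move=> sa sb; rewrite (rsum_parts sa) (rsum_parts sb).
have pa := summ_ppart sa; have na := summ_npart sa.
have pb := summ_ppart sb; have nb := summ_npart sb.
have pg (K : countType) := @ppart_ge0 R K.
have ng (K : countType) := @npart_ge0 R K.
rewrite (_ : pairfam a b = fun ij =>
    (pairfam (ppart a) (ppart b) ij + pairfam (npart a) (npart b) ij) -
    (pairfam (ppart a) (npart b) ij + pairfam (npart a) (ppart b) ij)); last first.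
  by apply/funext => ij; rewrite /pairfam {1}[a]ppartE {1}[b]ppartE; ring.
have spp := summ_pair pa pb; have snn := summ_pair na nb.
have spn := summ_pair pa nb; have snp := summ_pair na pb.
have f0 (c : I -> R) (d : J -> R) : (forall i, 0 <= c i) ->
  (forall i, 0 <= d i) -> forall ij, 0 <= pairfam c d ij.
  by move=> c0 d0 ij; rewrite mulr_ge0.
rewrite rsumB; first 1 last.
- exact: summD.
- exact: summD.
- by move=> ij; rewrite addr_ge0 ?f0.
- by move=> ij; rewrite addr_ge0 ?f0.
rewrite !nnsumD //; try exact: f0.
rewrite !nnsum_pair //; ring.
Qed.

End ProductSums.

(** * The modulus as a real number *)

Section NormC.
Context {R : realType}.
Implicit Types z w : R[i].

Definition cabs z : R := Num.sqrt (sqnorm z).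

Lemma cabs_ge0 z : 0 <= cabs z. Proof. exact: sqrtr_ge0. Qed.
Lemma sqr_cabs z : cabs z ^+ 2 = sqnorm z.
Proof. by rewrite sqr_sqrtr // sqnorm_ge0. Qed.
Lemma normr_cabs z : `|z| = (cabs z)%:C. Proof. exact: normc_def. Qed.
Lemma cabsM z w : cabs (z * w) = cabs z * cabs w.
Proof. by rewrite /cabs sqnormM sqrtrM // sqnorm_ge0. Qed.
Lemma cabsD z w : cabs (z + w) <= cabs z + cabs w.
Proof. by rewrite -lecR rmorphD /= -!normr_cabs ler_normD. Qed.
Lemma cabsN z : cabs (- z) = cabs z. Proof. by rewrite /cabs sqnormN. Qed.
Lemma cabs_conjc z : cabs (conjc z) = cabs z.
Proof. by rewrite /cabs sqnorm_conjc. Qed.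
Lemma cabs_real (x : R) : cabs (x%:C) = `|x|.
Proof. by rewrite /cabs /sqnorm !ReImE expr0n addr0 sqrtr_sqr. Qed.
Lemma cabsX z n : cabs (z ^+ n) = cabs z ^+ n.
Proof.
elim: n => [|n IH]; first by rewrite !expr0 (cabs_real 1) normr1.
by rewrite !exprS cabsM IH.
Qed.
Lemma cabs_nat n : cabs n%:R = n%:R.
Proof. by rewrite -(rmorph_nat (real_complex R)) cabs_real normr_nat. Qed.
Lemma cabsV z : cabs z^-1 = (cabs z)^-1.
Proof.
by apply: complexI; rewrite fmorphV /= -!normr_cabs normfV.
Qed.
Lemma Re_cabs z : `|complex.Re z| <= cabs z.
Proof.
by rewrite -(sqrtr_sqr (complex.Re z)) ler_wsqrtr // lerDl sqr_ge0.
Qed.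
Lemma Im_cabs z : `|complex.Im z| <= cabs z.
Proof.
by rewrite -(sqrtr_sqr (complex.Im z)) ler_wsqrtr // lerDr sqr_ge0.
Qed.
Lemma cabs_le z : cabs z <= `|complex.Re z| + `|complex.Im z|.
Proof.
rewrite -[leRHS]ger0_norm ?addr_ge0 // -sqrtr_sqr ler_wsqrtr // /sqnorm.
rewrite -(real_normK (num_real (complex.Re z))).
rewrite -(real_normK (num_real (complex.Im z))) sqrrD.
by rewrite lerD2r lerDl mulrn_wge0 // mulr_ge0.
Qed.
End NormC.

(** * Unordered sums of complex families *)

Section ComplexSums.
Context {R : realType} {I : countType}.
Implicit Types (a b : I -> R[i]) (B : I -> R).

Lemma summ_Re B a : rsummable B -> (forall i, cabs (a i) <= B i) ->
  rsummable (fun i => complex.Re (a i)).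
Proof.
by move=> sB aB; apply: (summ_le sB) => i; exact: le_trans (Re_cabs _) _.
Qed.

Lemma summ_Im B a : rsummable B -> (forall i, cabs (a i) <= B i) ->
  rsummable (fun i => complex.Im (a i)).
Proof.
by move=> sB aB; apply: (summ_le sB) => i; exact: le_trans (Im_cabs _) _.
Qed.

Lemma Re_csum a : complex.Re (csum a) = rsum (fun i => complex.Re (a i)).
Proof. by []. Qed.
Lemma Im_csum a : complex.Im (csum a) = rsum (fun i => complex.Im (a i)).
Proof. by []. Qed.

Lemma csum_lin (c : R[i]) B B' a b : rsummable B -> rsummable B' ->
  (forall i, cabs (a i) <= B i) -> (forall i, cabs (b i) <= B' i) ->
  csum (fun i => c * a i + b i) = c * csum a + csum b.
Proof.
move=> sB sB' aB bB.
have ra := summ_Re sB aB; have ia := summ_Im sB aB.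
have rb := summ_Re sB' bB; have ib := summ_Im sB' bB.
have lin2 (x y : R) (f g h : I -> R) : rsummable f -> rsummable g -> rsummable h ->
    rsum (fun i => x * f i + y * g i + h i) = x * rsum f + y * rsum g + rsum h.
  move=> sf sg sh; have sxf := summZ x sf; have syg := summZ y sg.
  by rewrite (rsumD (summD sxf syg) sh) (rsumD sxf syg) (rsumZ _ sf) (rsumZ _ sg).
apply: complex_eq; rewrite !ReImE !(Re_csum, Im_csum).
  rewrite -mulNr -(lin2 _ _ _ _ _ ra ia rb); congr rsum; apply/funext => i.
  by rewrite !ReImE mulNr.
rewrite -(lin2 _ _ _ _ _ ia ra ib); congr rsum; apply/funext => i.
by rewrite !ReImE.
Qed.

Lemma csum_conjc B a : rsummable B -> (forall i, cabs (a i) <= B i) ->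
  csum (fun i => conjc (a i)) = conjc (csum a).
Proof.
move=> sB aB; apply: complex_eq.
  rewrite Re_conjc !Re_csum; congr rsum; apply/funext => i.
  by rewrite Re_conjc.
rewrite Im_conjc !Im_csum -(rsumN (summ_Im sB aB)).
by congr rsum; apply/funext => i; rewrite ReImE.
Qed.

Lemma cabs_csum B a : rsummable B -> (forall i, cabs (a i) <= B i) ->
  cabs (csum a) <= 2 * nnsum B.
Proof.
move=> sB aB; apply: (le_trans (cabs_le _)); rewrite mulr_natl mulr2n.
apply: lerD; apply: rsum_le => // i; apply: le_trans (aB i).
  exact: Re_cabs.
exact: Im_cabs.
Qed.

Lemma csum_reindex (e : I -> I) a : bijective e ->
  csum (fun i => a (e i)) = csum a.
Proof.
move=> be; rewrite /csum.
rewrite (rsum_reindex (fun i => complex.Re (a i)) be).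
by rewrite (rsum_reindex (fun i => complex.Im (a i)) be).
Qed.

End ComplexSums.

Lemma csum_pair {R : realType} {I J : countType} (a : I -> R[i]) (b : J -> R[i])
    (A : I -> R) (B : J -> R) : rsummable A -> rsummable B ->
  (forall i, cabs (a i) <= A i) -> (forall j, cabs (b j) <= B j) ->
  csum (fun ij : I * J => a ij.1 * b ij.2) = csum a * csum b.
Proof.
move=> sA sB aA bB.
have ra := summ_Re sA aA; have ia := summ_Im sA aA.
have rb := summ_Re sB bB; have ib := summ_Im sB bB.
have srr := summ_pair ra rb; have sii := summ_pair ia ib.
have sri := summ_pair ra ib; have sir := summ_pair ia rb.
apply: complex_eq; rewrite !ReImE !(Re_csum, Im_csum) -!rsum_pair //.
  rewrite -mulN1r -(rsumZ (-1) sii) -rsumD //; last exact: summZ.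
  by congr rsum; apply/funext => ij; rewrite !ReImE mulN1r.
rewrite -rsumD //.
by congr rsum; apply/funext => ij; rewrite !ReImE.
Qed.

(** * A summable weight on the integers *)

Section IntSum.
Context {R : realType}.

Definition abs1p (n : int) : R := 1 + `|n|%N%:R.

Definition int_weight n : R := abs1p n ^- 2.

Lemma abs1p_ge1 n : 1 <= abs1p n. Proof. by rewrite /abs1p lerDl. Qed.

Lemma int_weight_ge0 n : 0 <= int_weight n.
Proof. by rewrite invr_ge0 exprn_ge0 // (le_trans ler01 (abs1p_ge1 n)). Qed.

(** The term [- 1 / k.+1] is what makes the induction close. *)
Lemma sum_inv_sqr_le (k : nat) :
  \sum_(i < k.+1) (1 + i%:R) ^- 2 <= 2 - (k.+1%:R)^-1 :> R.
Proof.
elim: k => [|k IH]; first by rewrite big_ord1 addr0 expr1n invr1; lra.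
rewrite big_ord_recr /=; apply: (le_trans (lerD IH (lexx _))).
rewrite -[k.+2%:R]natr1.
have : 0 < k.+1%:R :> R by rewrite ltr0n.
move: (k.+1%:R) => x x0.
have x1 : 0 < x + 1 by rewrite addr_gt0.
rewrite -subr_ge0 [X in _ <= X](_ : _ = (x * (x + 1) ^+ 2)^-1); last first.
  by rewrite [1 + x]addrC; field; rewrite !gt_eqF.
by rewrite invr_ge0 mulr_ge0 ?exprn_ge0 // ltW.
Qed.

(** The negative integer [- n.+1] is compared with the natural number [n]. *)
Lemma summ_int_weight : rsummable int_weight.
Proof.
have natsum : (\esum_(k in [set: nat]) ((1 + k%:R) ^- 2 : R)%:E <= 2%:E)%E.
  rewrite -nneseries_esumT; last first.
    by move=> k; rewrite lee_fin invr_ge0 exprn_ge0 // addr_ge0.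
  apply: lime_le.
    apply: is_cvg_nneseries => k _ _.
    by rewrite lee_fin invr_ge0 exprn_ge0 // addr_ge0.
  near=> k; rewrite sumEFin lee_fin big_mkord.
  have k0 : (0 < k)%N by near: k; exists 1%N.
  rewrite -(prednK k0); apply: (le_trans (sum_inv_sqr_le _)).
  by rewrite gerBl invr_ge0.
rewrite /rsummable /esumR (esumID [set n : int | 0 <= n]) //.
rewrite !setTI lte_add_pinfty //.
  rewrite (@reindex_esum R nat int setT _ Posz).
    apply: le_lt_trans (ltry 2); apply: le_trans natsum; apply: le_esum => k _.
    by rewrite lee_fin ger0_norm ?int_weight_ge0.
  split => //; [by move=> x y _ _ []|].
  by case=> n //= _; exists n.
rewrite (@reindex_esum R nat int setT _ Negz).
  apply: le_lt_trans (ltry 2); apply: le_trans natsum; apply: le_esum => k _.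
  rewrite lee_fin ger0_norm ?int_weight_ge0 // /int_weight /abs1p NegzE abszN absz_nat.
  rewrite lef_pV2 ?posrE ?exprn_gt0 ?ltr_pwDl //.
  by rewrite lerXn2r ?nnegrE ?addr_ge0 // lerD2l ler_nat.
split => //; [by move=> x y _ _ []|].
by case=> n //= _; exists n.
Unshelve. all: by end_near.
Qed.

End IntSum.

(** * Complex-valued integration and square integrable functions *)

Section CIntegral.
Context {R : realType}.
Notation mu := (@lebesgue_measure R).
Variable D : set R.
Hypotheses (mD : measurable (D : set (measurableTypeR R))) (fD : (mu D < +oo)%E).
Implicit Types (f g : R -> R[i]) (h : R -> R).

Definition cmeasurable g := measurable_fun D (fun t => complex.Re (g t)) /\
  measurable_fun D (fun t => complex.Im (g t)).
Definition rintegrable h := mu.-integrable D (EFin \o h).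
Definition cintegrable g := rintegrable (fun t => complex.Re (g t)) /\
  rintegrable (fun t => complex.Im (g t)).

Lemma rint_meas h : rintegrable h -> measurable_fun D h.
Proof. by move=> /integrableP[/measurable_EFinP]. Qed.

Lemma cint_cmeas g : cintegrable g -> cmeasurable g.
Proof. by case=> /rint_meas ? /rint_meas. Qed.

Lemma rint_bounded h b : measurable_fun D h ->
  (forall t, D t -> `|h t| <= b) -> rintegrable h.
Proof.
move=> mh hb; apply: measurable_bounded_integrable => //.
exists b; split; first exact: num_real.
by move=> x bx t /hb /= h1; rewrite (le_trans h1) // ltW.
Qed.

Lemma rint_le h h' : measurable_fun D h -> rintegrable h' ->
  (forall t, D t -> `|h t| <= h' t) -> rintegrable h.
Proof.
move=> mh ih' hh; apply: (le_integrable mD _ _ ih').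
  exact/measurable_EFinP.
by move=> t Dt /=; rewrite lee_fin (le_trans (hh t Dt)) // ler_norm.
Qed.

Lemma rintD h h' : rintegrable h -> rintegrable h' -> rintegrable (fun t => h t + h' t).
Proof. by move=> ih ih'; have := integrableD mD ih ih'. Qed.

Lemma rintZ c h : rintegrable h -> rintegrable (fun t => c * h t).
Proof. by move=> ih; have := integrableZl mD c ih. Qed.

Lemma cint_le g h : cmeasurable g -> rintegrable h ->
  (forall t, D t -> cabs (g t) <= h t) -> cintegrable g.
Proof.
move=> [m1 m2] ih gh; split; apply: (rint_le _ ih) => // t Dt.
  exact: le_trans (Re_cabs _) (gh t Dt).
exact: le_trans (Im_cabs _) (gh t Dt).
Qed.

Lemma cmeas_lin c f g : cmeasurable f -> cmeasurable g ->
  cmeasurable (fun t => c * f t + g t).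
Proof.
move=> [f1 f2] [g1 g2]; split.
  apply: (eq_measurable_fun (fun t => complex.Re c * complex.Re (f t) -
    complex.Im c * complex.Im (f t) + complex.Re (g t))).
    by move=> t _; rewrite !ReImE.
  apply: measurable_funD => //; apply: measurable_funB;
    apply: measurable_funM => //; exact: measurable_cst.
apply: (eq_measurable_fun (fun t => complex.Re c * complex.Im (f t) +
  complex.Im c * complex.Re (f t) + complex.Im (g t))).
  by move=> t _; rewrite !ReImE.
apply: measurable_funD => //; apply: measurable_funD;
  apply: measurable_funM => //; exact: measurable_cst.
Qed.

Lemma cmeasM f g : cmeasurable f -> cmeasurable g ->
  cmeasurable (fun t => f t * g t).
Proof.
move=> [f1 f2] [g1 g2]; split.
  apply: (eq_measurable_fun (fun t => complex.Re (f t) * complex.Re (g t) -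
    complex.Im (f t) * complex.Im (g t))).
    by move=> t _; rewrite !ReImE.
  by apply: measurable_funB; apply: measurable_funM.
apply: (eq_measurable_fun (fun t => complex.Re (f t) * complex.Im (g t) +
  complex.Im (f t) * complex.Re (g t))).
  by move=> t _; rewrite !ReImE.
by apply: measurable_funD; apply: measurable_funM.
Qed.

Lemma cmeas_conjc f : cmeasurable f -> cmeasurable (fun t => conjc (f t)).
Proof.
move=> [f1 f2]; split.
  by apply: eq_measurable_fun f1 => t _; rewrite Re_conjc.
apply: (eq_measurable_fun (fun t => - complex.Im (f t))).
  by move=> t _; rewrite Im_conjc.
exact: measurableT_comp.
Qed.

Lemma cmeas_cst c : cmeasurable (fun=> c).
Proof. by split; exact: measurable_cst. Qed.

Lemma cmeasB f g : cmeasurable f -> cmeasurable g ->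
  cmeasurable (fun t => f t - g t).
Proof.
move=> mf mg; have := cmeas_lin (-1) mg mf.
by congr cmeasurable; apply/funext => t; rewrite mulN1r addrC.
Qed.

Lemma meas_sqnorm f : cmeasurable f -> measurable_fun D (fun t => sqnorm (f t)).
Proof.
by move=> [f1 f2]; apply: measurable_funD; apply: measurable_funX.
Qed.

Lemma meas_cabs f : cmeasurable f -> measurable_fun D (fun t => cabs (f t)).
Proof.
move=> /meas_sqnorm mf; apply: measurableT_comp => //.
by apply: continuous_measurable_fun; exact: sqrt_continuous.
Qed.

Lemma rint_cabs f : cintegrable f -> rintegrable (fun t => cabs (f t)).
Proof.
move=> [i1 i2]; have a1 := integrable_abse i1; have a2 := integrable_abse i2.
have i : rintegrable (fun t => `|complex.Re (f t)| + `|complex.Im (f t)|).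
  by apply: rintD; [move: a1|move: a2]; congr (_.-integrable _ _);
    apply/funext => t.
apply: (rint_le _ i).
  by apply: meas_cabs; apply: cint_cmeas.
by move=> t _; rewrite ger0_norm ?cabs_ge0 //; exact: cabs_le.
Qed.

Lemma eq_cintegral f g : (forall t, D t -> f t = g t) ->
  cintegral D f = cintegral D g.
Proof.
move=> fg; rewrite /cintegral; congr (_ +i* _);
  by apply: eq_Rintegral => t /set_mem Dt; rewrite fg.
Qed.

Lemma Re_cintegral f :
  complex.Re (cintegral D f) = \int[mu]_(t in D) complex.Re (f t).
Proof. by []. Qed.
Lemma Im_cintegral f :
  complex.Im (cintegral D f) = \int[mu]_(t in D) complex.Im (f t).
Proof. by []. Qed.

Lemma cint_lin c f g : cintegrable f -> cintegrable g ->
  cintegrable (fun t => c * f t + g t).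
Proof.
move=> cf cg; apply: (@cint_le _ (fun t => cabs c * cabs (f t) + cabs (g t))).
- by apply: cmeas_lin; exact: cint_cmeas.
- by apply: rintD; [apply: rintZ|]; exact: rint_cabs.
- by move=> t _; rewrite -cabsM; exact: cabsD.
Qed.

Lemma cintegral_lin c f g : cintegrable f -> cintegrable g ->
  cintegral D (fun t => c * f t + g t) = c * cintegral D f + cintegral D g.
Proof.
move=> [f1 f2] [g1 g2].
have lin2 (x y : R) (p q r : R -> R) : rintegrable p -> rintegrable q ->
    rintegrable r ->
    \int[mu]_(t in D) (x * p t + y * q t + r t) =
    x * \int[mu]_(t in D) p t + y * \int[mu]_(t in D) q t +
    \int[mu]_(t in D) r t.
  move=> ip iq ir; rewrite RintegralD //; last first.
    by apply: rintD; exact: rintZ.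
  by rewrite RintegralD ?RintegralZl //; exact: rintZ.
apply: complex_eq.
  rewrite ReD ReM !Re_cintegral Im_cintegral -mulNr.
  rewrite -(lin2 _ _ _ _ _ f1 f2 g1); apply: eq_Rintegral => t _.
  by rewrite !ReImE mulNr.
rewrite ImD ImM !Im_cintegral Re_cintegral.
by rewrite -(lin2 _ _ _ _ _ f2 f1 g2); apply: eq_Rintegral => t _; rewrite !ReImE.
Qed.

Lemma cintegral_conjc f : cintegrable f ->
  cintegral D (fun t => conjc (f t)) = conjc (cintegral D f).
Proof.
move=> [f1 f2]; apply: complex_eq.
  by rewrite Re_conjc !Re_cintegral; apply: eq_Rintegral => t _; rewrite Re_conjc.
rewrite Im_conjc !Im_cintegral -mulN1r -RintegralZl //.
by apply: eq_Rintegral => t _; rewrite Im_conjc mulN1r.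
Qed.

Lemma cabs_cintegral f h : cmeasurable f -> rintegrable h ->
  (forall t, D t -> cabs (f t) <= h t) ->
  cabs (cintegral D f) <= 2 * \int[mu]_(t in D) h t.
Proof.
move=> mf ih fh; have [i1 i2] := cint_le mf ih fh.
have le1 (g : R -> R) : rintegrable g -> (forall t, D t -> `|g t| <= h t) ->
    `|\int[mu]_(t in D) g t| <= \int[mu]_(t in D) h t.
  move=> ig gh; apply: (le_trans (le_normr_Rintegral mD ig)).
  apply: le_Rintegral => //.
  have := integrable_abse ig; congr (_.-integrable _ _).
apply: (le_trans (cabs_le _)); rewrite mulr_natl mulr2n; apply: lerD.
  by apply: le1 => // t Dt; exact: le_trans (Re_cabs _) (fh t Dt).
by apply: le1 => // t Dt; exact: le_trans (Im_cabs _) (fh t Dt).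
Qed.

Section Csum.
Context {I : countType} (F : I -> R -> R[i]) (B : I -> R).
Hypotheses (sB : rsummable B) (B0 : forall i, 0 <= B i).
Hypothesis mF : forall i, cmeasurable (F i).
Hypothesis FB : forall i t, D t -> cabs (F i t) <= B i.

Lemma cmeas_csum : cmeasurable (fun t => csum (F ^~ t)).
Proof.
split.
  have [] // := @rsum_measurable_integral R I _ _ mu D
    (fun i t => complex.Re (F i t)) B mD fD sB B0.
  - by move=> i; case: (mF i).
  - by move=> i t Dt; exact: le_trans (Re_cabs _) (FB i Dt).
have [] // := @rsum_measurable_integral R I _ _ mu D
  (fun i t => complex.Im (F i t)) B mD fD sB B0.
- by move=> i; case: (mF i).
- by move=> i t Dt; exact: le_trans (Im_cabs _) (FB i Dt).
Qed.

Lemma cintegral_csum : cintegral D (fun t => csum (F ^~ t)) =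
  csum (fun i => cintegral D (F i)).
Proof.
apply: complex_eq.
  have [|| _ E] := @rsum_measurable_integral R I _ _ mu D
    (fun i t => complex.Re (F i t)) B mD fD sB B0.
  - by move=> i; case: (mF i).
  - by move=> i t Dt; exact: le_trans (Re_cabs _) (FB i Dt).
  by rewrite Re_csum -E.
have [|| _ E] := @rsum_measurable_integral R I _ _ mu D
  (fun i t => complex.Im (F i t)) B mD fD sB B0.
- by move=> i; case: (mF i).
- by move=> i t Dt; exact: le_trans (Im_cabs _) (FB i Dt).
by rewrite Im_csum -E.
Qed.

End Csum.

(** Square integrability through [rintegrable], for a general domain; for an open
    time interval it agrees with [L2], see [L2P] below. *)
Definition L2on u := cmeasurable u /\ rintegrable (fun t => sqnorm (u t)).
Definition L2ip u v := cintegral D (fun t => u t * conjc (v t)).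

Lemma L2on_mul u v : L2on u -> L2on v -> cintegrable (fun t => u t * conjc (v t)).
Proof.
move=> [mu iu] [mv iv].
apply: (@cint_le _ (fun t => sqnorm (u t) + sqnorm (v t))).
- by apply: cmeasM => //; exact: cmeas_conjc.
- exact: rintD.
- move=> t _; rewrite cabsM cabs_conjc -!sqr_cabs.
  by have := sqr_ge0 (cabs (u t) - cabs (v t));
    have := mulr_ge0 (cabs_ge0 (u t)) (cabs_ge0 (v t)); nra.
Qed.

Lemma L2on_lin a u v : L2on u -> L2on v -> L2on (fun t => a * u t + v t).
Proof.
move=> [mu iu] [mv iv]; split; first exact: cmeas_lin.
apply: (@rint_le _ (fun t => (2 * sqnorm a) * sqnorm (u t) + 2 * sqnorm (v t))).
- by apply: meas_sqnorm; exact: cmeas_lin.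
- by apply: rintD; exact: rintZ.
- move=> t _; rewrite ger0_norm ?sqnorm_ge0 // -mulrA -sqnormM.
  exact: sqnormD_le.
Qed.

Lemma sqn_L2ip u : sqn L2ip u = \int[mu]_(t in D) sqnorm (u t).
Proof.
rewrite /sqn /L2ip Re_cintegral; apply: eq_Rintegral => t _.
by rewrite !ReImE /sqnorm; ring.
Qed.

Lemma L2on_pre_hilbert : pre_hilbert L2on L2ip.
Proof.
split.
- split; first exact: cmeas_cst.
  apply: (@rint_bounded _ 0) => [|t _].
    by apply: meas_sqnorm; exact: cmeas_cst.
  by rewrite /sqnorm /= expr0n addr0 normr0.
- exact: L2on_lin.
- move=> a f g h Lf Lg Lh; rewrite /L2ip -cintegral_lin; try exact: L2on_mul.
  by apply: eq_cintegral => t _; rewrite mulrDl mulrA.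
- move=> f g Lf Lg; rewrite /L2ip -cintegral_conjc; last exact: L2on_mul.
  by apply: eq_cintegral => t _; rewrite rmorphM /= conjcK mulrC.
- move=> f Lf; rewrite lecE; apply/andP; split.
    rewrite /L2ip Im_cintegral (@eq_Rintegral _ _ _ mu D (cst 0)).
      by rewrite Rintegral_cst // mul0r.
    by move=> t _; rewrite !ReImE /=; ring.
  rewrite -/(sqn L2ip f) sqn_L2ip; apply: Rintegral_ge0 => t _.
  exact: sqnorm_ge0.
Qed.

Lemma sqnormB_cvg (a : nat -> R[i]) (z c : R[i]) :
  (fun k => complex.Re (a k)) @ \oo --> complex.Re z ->
  (fun k => complex.Im (a k)) @ \oo --> complex.Im z ->
  (fun k => (sqnorm (c - a k))%:E) @ \oo --> (sqnorm (c - z))%:E.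
Proof.
move=> h1 h2; apply: cvg_EFin; first by near=> k.
rewrite (_ : fine \o _ = fun k =>
  (complex.Re c - complex.Re (a k)) * (complex.Re c - complex.Re (a k)) +
  (complex.Im c - complex.Im (a k)) * (complex.Im c - complex.Im (a k))); last first.
  by apply/funext => k /=; rewrite /sqnorm !ReImE !expr2.
rewrite /sqnorm !ReImE !expr2.
by apply: cvgD; apply: cvgM; apply: cvgB => //; exact: cvg_cst.
Unshelve. all: by end_near.
Qed.

Lemma cvg_abs_increments (a : nat -> R) (d : nat -> R) :
  (forall k, `|a k.+1 - a k| <= d k) ->
  (\sum_(0 <= k <oo) (d k)%:E < +oo)%E -> cvgn a.
Proof.
move=> ad dfin.
have d0 k : 0 <= d k by exact: le_trans (ad k).
have cd : cvgn (series d).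
  apply: nondecreasing_is_cvgn.
    apply/nondecreasing_seqP => n; rewrite /series /= big_nat_recr //=.
    by rewrite lerDl.
  exists (fine (\sum_(0 <= k <oo) (d k)%:E)%E) => _ [n _ <-].
  rewrite -lee_fin fineK; last first.
    by rewrite ge0_fin_numE //; apply: nneseries_ge0 => k _ _; rewrite lee_fin.
  rewrite /series /= -sumEFin.
  by apply: nneseries_lim_ge => k _ _; rewrite lee_fin.
have ct : cvgn (series (telescope a)).
  apply: normed_cvg; apply: (series_le_cvg _ d0 _ cd) => k /=.
    exact: normr_ge0.
  exact: ad.
rewrite (_ : a = (fun n => a 0%N + series (telescope a) n)).
  by apply: is_cvgD => //; exact: is_cvg_cst.
by apply/funext => n; rewrite -eq_sum_telescope.
Qed.

Lemma limn_einf_le (x : nat -> \bar R) (c : \bar R) :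
  (forall k, (x k <= c)%E) -> (limn_einf x <= c)%E.
Proof.
move=> xc; rewrite limn_einf_lim; apply: lime_le; first exact: is_cvg_einfs.
near=> n; apply: le_trans (xc n); apply: ereal_inf_lbound.
by exists n => /=.
Unshelve. all: by end_near.
Qed.

Lemma cvg_fine_limn_esup (a : nat -> R) : cvgn a ->
  a @ \oo --> fine (limn_esup (fun k => (a k)%:E)).
Proof.
move=> ca; have c : (fun k => (a k)%:E) @ \oo --> (limn a)%:E.
  by apply: cvg_EFin; [near=> k|exact: ca].
by rewrite (cvg_limn_einf_sup c).2; exact: ca.
Unshelve. all: by end_near.
Qed.

(** A subsequence has increments of squared norm less than [4^-k].  For [c > 0] one
    has [d <= c + d^2 / c]; with [c = 2^-k] this makes the moduli of the increments
    summable in mean on a domain of finite measure, hence summable almost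
    everywhere, so that the subsequence converges almost everywhere.  Fatou's lemma
    bounds the distance to the limit. *)
Lemma L2on_complete : complete_space L2on L2ip.
Proof.
move=> u Lu cau; have ph := L2on_pre_hilbert.
pose q : R := 4^-1.
have q0 k : 0 < q ^+ k by rewrite exprn_gt0 // invr_gt0.
have [N hN] := choice (fun k => cau (q ^+ k) (q0 k)).
pose phi k := \max_(j < k.+1) N j.
have Nphi j k : (j <= k)%N -> (N j <= phi k)%N.
  rewrite -ltnS => jk.
  exact: (@leq_bigmax _ (fun i : 'I_k.+1 => N i) (Ordinal jk)).
pose v k := u (phi k).
have Lv k : L2on (v k) by exact: Lu.
have vB j k m : (j <= k)%N -> (N j <= m)%N -> sqn L2ip (u m \- v k) < q ^+ j.
  by move=> jk Nm; apply: hN => //; exact: Nphi.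
have mv k : cmeasurable (v k) by case: (Lv k).
have mdiff f g : L2on f -> L2on g -> L2on (fun t => f t - g t).
  exact: (ph_sub ph).
pose d k t := cabs (v k.+1 t - v k t).
have d0 k t : 0 <= d k t by exact: cabs_ge0.
have md k : measurable_fun D (d k) by apply: meas_cabs; exact: cmeasB.
pose M := fine (mu D) + 1.
have id_le k : (\int[mu]_(t in D) (d k t)%:E <= ((2 * M) / (2 ^ k.+1)%:R)%:E)%E.
  pose c : R := 2^-1 ^+ k.
  have c0 : 0 < c by rewrite exprn_gt0 // invr_gt0.
  have dle t : D t -> `|d k t| <= c + c^-1 * sqnorm (v k.+1 t - v k t).
    move=> _; rewrite ger0_norm // -sqr_cabs -/(d k t).
    rewrite -(ler_pM2l c0) mulrDr mulrA divff ?gt_eqF // mul1r.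
    have := d0 k t; have := sqr_ge0 (c - d k t); nra.
  have i2 : rintegrable (fun t => sqnorm (v k.+1 t - v k t)).
    by case: (mdiff _ _ (Lv k.+1) (Lv k)).
  have i1 : rintegrable (fun t => c + c^-1 * sqnorm (v k.+1 t - v k t)).
    apply: rintD; last exact: rintZ.
    apply: (@rint_bounded _ c); first exact: measurable_cst.
    by move=> t _; rewrite gtr0_norm.
  have idk : rintegrable (d k) by exact: rint_le i1 _.
  rewrite -[leLHS]fineK; last exact: integrable_fin_num.
  rewrite lee_fin -/(Rintegral mu D (d k)).
  apply: (@le_trans _ _ (c * fine (mu D) + c^-1 * q ^+ k)).
    apply: (@le_trans _ _ (\int[mu]_(t in D)
       (c + c^-1 * sqnorm (v k.+1 t - v k t)))).
      apply: le_Rintegral => // t Dt.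
      by apply: le_trans (dle t Dt); exact: ler_norm.
    rewrite RintegralD //; last exact: rintZ.
      rewrite Rintegral_cst // RintegralZl // lerD2l ler_pM2l ?invr_gt0 //.
      rewrite -(sqn_L2ip (v k.+1 \- v k)); apply/ltW.
      by apply: vB => //; exact: Nphi.
    apply: (@rint_bounded _ c); first exact: measurable_cst.
    by move=> t _; rewrite gtr0_norm.
  rewrite natrX exprS invfM mulrACA divff // mul1r.
  have -> : q ^+ k = c * c.
    by rewrite /q /c -exprMn -invfM; congr (_^-1 ^+ _); rewrite -natrM.
  rewrite mulKf ?gt_eqF // -exprVn -/c /M mulrDl mul1r.
  by rewrite [c * fine _]mulrC.
have M0 : 0 <= M by rewrite addr_ge0 // fine_ge0.
pose S t : \bar R := (\sum_(0 <= k <oo) (d k t)%:E)%E.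
have iS : (\int[mu]_(t in D) S t < +oo)%E.
  rewrite /S integral_nneseries //; first last.
  - by move=> k t _; rewrite lee_fin.
  - by move=> k; apply/measurable_EFinP; exact: md.
  apply: (@le_lt_trans _ _ (2 * M)%:E); last exact: ltry.
  apply: (@le_trans _ _ (\sum_(0 <= k <oo) ((2 * M) / (2 ^ k.+1)%:R)%:E)%E).
    apply: lee_nneseries => k _; last exact: id_le.
    by move=> _; apply: integral_ge0 => t _; rewrite lee_fin.
  by apply: epsilon_trick0; rewrite mulr_ge0.
have S0 t : (0 <= S t)%E.
  by apply: nneseries_ge0 => k _ _; rewrite lee_fin.
have mS : measurable_fun D S.
  have := @ge0_emeasurable_sum _ _ R D (fun k t => (d k t)%:E) xpredT.
  apply=> [k t _ _|k _]; first by rewrite lee_fin.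
  by apply/measurable_EFinP; exact: md.
have aeS : \forall t \ae mu, D t -> S t \is a fin_num.
  apply: integrable_ae => //; apply/integrableP; split => //.
  apply: le_lt_trans iS; rewrite le_eqVlt; apply/orP; left; apply/eqP.
  by apply: eq_integral => t _; exact: gee0_abs.
(* the upper limit makes [w] measurable even where the sequence diverges *)
pose w t := fine (limn_esup (fun k => (complex.Re (v k t))%:E)) +i*
  fine (limn_esup (fun k => (complex.Im (v k t))%:E)).
have mw : cmeasurable w.
  split.
    apply: (@measurableT_comp _ _ _ _ _ _ fine).
      exact: fine_measurable.
    apply: measurable_fun_limn_esup => k; apply/measurable_EFinP.
    by case: (mv k).
  apply: (@measurableT_comp _ _ _ _ _ _ fine).
    exact: fine_measurable.
  apply: measurable_fun_limn_esup => k; apply/measurable_EFinP.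
  by case: (mv k).
have vw t : S t \is a fin_num ->
    ((fun k => complex.Re (v k t)) @ \oo --> complex.Re (w t)) /\
    ((fun k => complex.Im (v k t)) @ \oo --> complex.Im (w t)).
  rewrite ge0_fin_numE // => St; split.
    apply: cvg_fine_limn_esup; apply: cvg_abs_increments St => k.
    by apply: le_trans (Re_cabs _); rewrite !ReImE.
  apply: cvg_fine_limn_esup; apply: cvg_abs_increments St => k.
  by apply: le_trans (Im_cabs _); rewrite !ReImE.
have fat j m : (N j <= m)%N ->
    (\int[mu]_(t in D) (sqnorm (u m t - w t))%:E <= (q ^+ j)%:E)%E.
  move=> Nm.
  pose f k t := (sqnorm (u m t - v (k + j)%N t))%:E.
  have mum : cmeasurable (u m) by case: (Lu m).
  have mf k : measurable_fun D (f k).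
    by apply/measurable_EFinP; apply: meas_sqnorm; exact: cmeasB.
  rewrite (@ae_eq_integral _ _ _ mu D (fun t => limn_einf (f ^~ t))) //.
  - apply: (@le_trans _ _ (limn_einf (fun k => \int[mu]_(t in D) f k t)%E)).
      by apply: fatou => // k t _; rewrite lee_fin sqnorm_ge0.
    apply: limn_einf_le => k.
    have i2 : rintegrable (fun t => sqnorm (u m t - v (k + j)%N t)).
      by case: (mdiff _ _ (Lu m) (Lv (k + j)%N)).
    rewrite -[leLHS]fineK; last exact: integrable_fin_num.
    rewrite lee_fin.
    have := @sqn_L2ip (u m \- v (k + j)%N); rewrite /Rintegral => <-.
    by apply/ltW/vB => //; exact: leq_addl.
  - by apply/measurable_EFinP; apply: meas_sqnorm; exact: cmeasB.
  - apply: (eq_measurable_fun (fun t => (- limn_esup (fun k => - f k t))%E)).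
      move=> t _; rewrite -limn_einfN; congr limn_einf; apply/funext => k /=.
      by rewrite opprK.
    apply: measurableT_comp => //; apply: measurable_fun_limn_esup => k.
    exact: measurableT_comp.
  - apply: negligibleS aeS; apply: subsetC => t h Dt; apply/esym.
    have [v1 v2] := vw t (h Dt).
    have c : (fun k => f k t) @ \oo --> (sqnorm (u m t - w t))%:E.
      have c := @sqnormB_cvg _ _ (u m t) v1 v2.
      by move: c; rewrite -(cvg_shiftn j).
    by rewrite (cvg_limn_einf_sup c).1.
have Ldiff m : (N 0%N <= m)%N -> L2on (fun t => u m t - w t).
  move=> Nm; have mB : cmeasurable (fun t => u m t - w t).
    by apply: cmeasB => //; case: (Lu m).
  split => //; apply/integrableP; split.
    by apply/measurable_EFinP; exact: meas_sqnorm.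
  apply: le_lt_trans (ltry (q ^+ 0)); apply: le_trans (fat _ _ Nm).
  rewrite le_eqVlt; apply/orP; left; apply/eqP; apply: eq_integral => t _.
  by rewrite /= ger0_norm ?sqnorm_ge0.
have Lw : L2on w.
  have := mdiff _ _ (Lu (N 0%N)) (Ldiff _ (leqnn _)).
  by congr L2on; apply/funext => t; rewrite opprB addrC subrK.
exists w => // e e0.
have [j _ hj] : \forall j \near \oo, q ^+ j < e.
  have := @cvg_geometric R 1 q.
  rewrite ger0_norm ?invr_ge0 // => /(_ _)/cvgrPdist_lt => h.
  have := h _ e e0; rewrite invf_lt1 // ltr1n => /(_ isT).
  apply: filterS => j; rewrite /= sub0r normrN mul1r ger0_norm //.
  exact: ltW.
exists (maxn (N j) (N 0%N)) => n Nn.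
rewrite sqn_L2ip; apply: le_lt_trans (hj j (leqnn _)).
rewrite -lee_fin /Rintegral fineK.
  by apply: fat; apply: leq_trans Nn; exact: leq_maxl.
apply: integrable_fin_num => //.
by have [|_] := Ldiff n; first by apply: leq_trans Nn; exact: leq_maxr.
Unshelve. all: by end_near.
Qed.

End CIntegral.

(** * The complex exponential to second order *)

Section ComplexExp.
Context {R : realType}.
Implicit Types (z w : R[i]) (a b x : R).

Lemma cexpD z w : cexp (z + w) = cexp z * cexp w.
Proof.
rewrite /cexp ReD ImD expRD cosD sinD.
by apply: complex_eq; rewrite !(ReM, ImM) /=; ring.
Qed.

Lemma cabs_cexp z : cabs (cexp z) = expR (complex.Re z).
Proof.
rewrite /cexp cabsM cabs_real ger0_norm ?expR_ge0 //.
by rewrite /cabs /sqnorm /= cos2Dsin2 sqrtr1 mulr1.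
Qed.

Lemma cexp_conjc z : cexp (conjc z) = conjc (cexp z).
Proof.
by apply: complex_eq; rewrite /cexp !ReImE /= ?cosN ?sinN; ring.
Qed.

Lemma MVT_at0 (f df : R -> R) b : (forall x, is_derive x 1 f (df x)) ->
  exists2 c, `|c| <= `|b| & f b - f 0 = df c * b.
Proof.
move=> fd.
have cf x y : {within `[x, y], continuous f}.
  apply: continuous_subspaceT => u; apply: differentiable_continuous.
  by apply/derivable1_diffP; case: (fd u).
have [b0|/ltW b0] := leP 0 b.
  have [c] := MVT_segment b0 (fun x _ => fd x) (cf _ _).
  rewrite in_itv /= => /andP[c0 cb] ->; exists c; last by rewrite subr0.
  by rewrite !ger0_norm.
have [c] := MVT_segment b0 (fun x _ => fd x) (cf _ _).
rewrite in_itv /= => /andP[cb c0] e; exists c.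
  by rewrite !ler0_norm // lerN2.
by rewrite -opprB e sub0r mulrN opprK.
Qed.

Lemma sin_le b : `|sin b| <= `|b|.
Proof.
have [c _] := MVT_at0 b (@is_derive_sin R).
rewrite sin0 subr0 => ->; rewrite normrM ler_piMl //; exact: cos_max.
Qed.

Lemma cos_sub1_le b : `|cos b - 1| <= b ^+ 2.
Proof.
have [c cb] := MVT_at0 b (@is_derive_cos R).
rewrite cos0 => ->; rewrite normrM normrN -[leRHS]real_normK ?num_real //.
by rewrite expr2 ler_wpM2r // (le_trans (sin_le _)).
Qed.

Lemma sin_sub_le b : `|sin b - b| <= b ^+ 2.
Proof.
have fd x : is_derive x 1 (fun y : R => sin y - y) (cos x - 1).
  by apply: is_deriveB.
have [c cb] := MVT_at0 b fd.
rewrite sin0 !subr0 => ->; rewrite normrM -[leRHS]real_normK ?num_real //.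
rewrite expr2 ler_wpM2r // (le_trans _ cb) //.
have [c' _] := MVT_at0 c (@is_derive_cos R).
rewrite cos0 => ->; rewrite normrM normrN ler_piMl //; exact: sin_max.
Qed.

Lemma expR_ge1 a : 0 <= a -> 1 <= expR a.
Proof. by move=> a0; have := expR_ge1Dx a; lra. Qed.

Lemma expR_sub1_le a : `|expR a - 1| <= `|a| * expR `|a|.
Proof.
have h : expR a - 1 <= a * expR a.
  have := expR_ge1Dx (- a); rewrite expRN => h.
  have := expR_gt0 a => e0.
  move: h; rewrite -(ler_pM2r e0) mulVf ?gt_eqF //; lra.
have h' := expR_ge1Dx a.
have [a0|a0] := leP 0 a.
  by rewrite (ger0_norm a0) ger0_norm // subr_ge0; lra.
rewrite ler_norml; apply/andP; split.
  rewrite (ltr0_norm a0).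
  have hE : 1 <= expR (- a) by rewrite expR_ge1 // oppr_ge0 ltW.
  have : a * (expR (- a) - 1) <= 0 by rewrite nmulr_rle0 // subr_ge0.
  lra.
apply: le_trans h _; apply: (@le_trans _ _ 0).
  by rewrite nmulr_rle0 ?expR_ge0.
by rewrite mulr_ge0 ?expR_ge0 // oppr_ge0 ltW.
Qed.

Lemma expR_taylor2 a : `|expR a - 1 - a| <= a ^+ 2 * expR `|a|.
Proof.
have h' := expR_ge1Dx a.
rewrite ger0_norm; last by lra.
have h : expR a - 1 - a <= a * (expR a - 1).
  have := expR_ge1Dx (- a); rewrite expRN => h.
  have := expR_gt0 a => e0.
  move: h; rewrite -(ler_pM2r e0) mulVf ?gt_eqF //; lra.
apply: (le_trans h); apply: (le_trans (ler_norm _)); rewrite normrM.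
rewrite -[a ^+ 2]real_normK ?num_real // expr2 -mulrA ler_wpM2l //.
exact: expR_sub1_le.
Qed.

(** Real and imaginary parts are expanded separately from the bounds above; the
    cross term is absorbed by [2 |a| |b| <= a^2 + b^2]. *)
Lemma cexp_taylor2 w :
  cabs (cexp w - 1 - w) <= 3 * cabs w ^+ 2 * expR (cabs w).
Proof.
set a := complex.Re w; set b := complex.Im w.
have E1 : 1 <= expR `|a| by rewrite expR_ge1.
have Ea : expR a <= expR `|a| by rewrite ler_expR ler_norm.
apply: (@le_trans _ _ (3 * cabs w ^+ 2 * expR `|a|)); last first.
  rewrite ler_wpM2l ?ler_expR ?Re_cabs //.
  by rewrite mulr_ge0 // sqr_ge0.
rewrite sqr_cabs /sqnorm -/a -/b; apply: (le_trans (cabs_le _)).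
have -> : complex.Re (cexp w - 1 - w) = (expR a - 1 - a) + expR a * (cos b - 1).
  by rewrite /cexp !ReImE /= -/a -/b; ring.
have -> : complex.Im (cexp w - 1 - w) = (expR a - 1) * sin b + (sin b - b).
  by rewrite /cexp !ReImE /= -/a -/b; ring.
have h1 : `|(expR a - 1 - a) + expR a * (cos b - 1)| <=
    (a ^+ 2 + b ^+ 2) * expR `|a|.
  apply: (le_trans (ler_normD _ _)); rewrite mulrDl lerD ?expR_taylor2 //.
  rewrite normrM ger0_norm ?expR_ge0 // mulrC.
  by rewrite ler_pM ?expR_ge0 // cos_sub1_le.
have h2 : `|(expR a - 1) * sin b + (sin b - b)| <=
    (`|a| * `|b| + b ^+ 2) * expR `|a|.
  apply: (le_trans (ler_normD _ _)); rewrite [leRHS]mulrDl lerD //.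
    rewrite normrM mulrAC; apply: ler_pM => //; [exact: expR_sub1_le|exact: sin_le].
  by apply: (le_trans (sin_sub_le _)); rewrite ler_peMr // sqr_ge0.
apply: (le_trans (lerD h1 h2)); rewrite -mulrDl ler_wpM2r ?expR_ge0 //.
have := sqr_ge0 (`|a| - `|b|); rewrite sqrrB !real_normK ?num_real //.
have := sqr_ge0 a; have := sqr_ge0 b; lra.
Qed.

End ComplexExp.

(** * The heat kernel off the real axis *)

Section HeatKernel.
Context {R : realType}.
Implicit Types (z w h : R[i]) (t T : R).

Definition heat_coef t : R := (4 * Num.sqrt pi * t `^ (3 / 2))^-1.

(** The complex derivative of [dxK] in its space variable. *)
Definition dxxK z t : R[i] :=
  - (heat_coef t)%:C * ((1 - z ^+ 2 / (2 * t)%:C) * cexp (- (z ^+ 2 / (4 * t)%:C))).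

Lemma dxKE z t : dxK z t = - (heat_coef t)%:C * (z * cexp (- (z ^+ 2 / (4 * t)%:C))).
Proof. by rewrite /dxK /heat_coef fmorphV /=; ring. Qed.

Lemma heat_coef_ge0 t : 0 <= heat_coef t.
Proof. by rewrite invr_ge0 mulr_ge0 ?powR_ge0 // mulr_ge0 // sqrtr_ge0. Qed.

Lemma cabs_heat z t : cabs (cexp (- (z ^+ 2 / (4 * t)%:C))) =
  expR (- (complex.Re (z ^+ 2) / (4 * t))).
Proof.
rewrite cabs_cexp -fmorphV ReN ReM Re_realc Im_realc mulr0 subr0 //.
Qed.

(** Trading [t^(-3/2)] for [t^-2] leaves only integer powers of [t] to compare with
    the Gaussian. *)
Lemma heat_coef_bound t T : 0 < t < T ->
  heat_coef t <= heat_coef 1 * Num.sqrt T / t ^+ 2.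
Proof.
move=> /andP[t0 tT]; rewrite /heat_coef powR1 mulr1.
have pi0 : 0 < 4 * Num.sqrt pi :> R by rewrite mulr_gt0 // sqrtr_gt0 pi_gt0.
rewrite invfM -mulrA ler_pM2l ?invr_gt0 //.
have p0 : 0 < t `^ (3 / 2) by rewrite powR_gt0.
rewrite -[leLHS]mul1r ler_pdivrMr // mulrAC ler_pdivlMr ?exprn_gt0 // mul1r.
have -> : t ^+ 2 = t `^ (1 / 2) * t `^ (3 / 2).
  rewrite -powRD; last by rewrite gt_eqF // implybT.
  by rewrite -powR_mulrn ?ltW //; congr (_ `^ _); field.
have T0 : 0 < T by exact: lt_trans tT.
rewrite ler_pM2r // div1r -powR12_sqrt ?(ltW T0) //.
by apply: ge0_ler_powR; rewrite ?nnegrE ?invr_ge0 // ltW.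
Qed.

(** After factoring out the exponential at [z], this is [cexp_taylor2] for the
    exponent increment [w].  The resulting factor [expR (cabs w)] is large when [t]
    is small, so it is merged with the Gaussian at [z]: the sum of the two exponents
    stays negative while [3 * A * cabs h] is below the real part of [z ^+ 2]. *)
Lemma dxK_taylor z h t (A : R) : 0 < t -> 1 <= A -> cabs z <= A ->
  cabs h <= 1 ->
  cabs (dxK (z + h) t - dxK z t - h * dxxK z t) <=
  cabs h ^+ 2 * (heat_coef t * (6 * A ^+ 3 / t ^+ 2 + A / t) *
    expR ((3 * A * cabs h - complex.Re (z ^+ 2)) / (4 * t))).
Proof.
move=> t0 A1 zA h1.
pose w := - ((2 * z * h + h ^+ 2) / (4 * t)%:C).
have A0 : 0 <= A by exact: le_trans A1.
have tC : (t%:C : R[i]) != 0 by rewrite fmorph_eq0 gt_eqF.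
have E : dxK (z + h) t - dxK z t - h * dxxK z t =
    - (heat_coef t)%:C * (cexp (- (z ^+ 2 / (4 * t)%:C)) *
      ((z + h) * (cexp w - 1 - w) - h ^+ 2 * (3 * z + h) / (4 * t)%:C)).
  rewrite !dxKE /dxxK.
  have -> : cexp (- ((z + h) ^+ 2 / (4 * t)%:C)) =
      cexp (- (z ^+ 2 / (4 * t)%:C)) * cexp w.
    by rewrite -cexpD; congr cexp; rewrite /w; ring.
  move: (cexp _) (cexp w) => X Y; rewrite /w.
  have -> : (4 * t)%:C = 4 * t%:C :> R[i] by rewrite rmorphM rmorph_nat.
  have -> : (2 * t)%:C = 2 * t%:C :> R[i] by rewrite rmorphM rmorph_nat.
  by field.
have h0 := cabs_ge0 h; have z0 := cabs_ge0 z.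
have hB : cabs (2 * z * h + h ^+ 2) <= 3 * A * cabs h.
  apply: (le_trans (cabsD _ _)); rewrite cabsX 2!cabsM cabs_nat; nra.
have c4t : cabs ((4 * t)%:C)^-1 = (4 * t)^-1.
  by rewrite cabsV cabs_real gtr0_norm // mulr_gt0.
have wB : cabs w <= 3 * A * cabs h / (4 * t).
  by rewrite /w cabsN cabsM c4t ler_wpM2r // invr_ge0 mulr_ge0 // ltW.
have wB' : cabs w <= A * cabs h / t.
  apply: (le_trans wB); rewrite ler_pdivrMr ?mulr_gt0 //.
  rewrite [leRHS](_ : _ = 4 * (A * cabs h)); last by field; rewrite gt_eqF.
  by have := mulr_ge0 A0 h0; lra.
have eB : expR (cabs w) <= expR (3 * A * cabs h / (4 * t)) by rewrite ler_expR.
rewrite E cabsM cabsN cabs_real ger0_norm ?heat_coef_ge0 // cabsM cabs_heat.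
rewrite mulrBl expRD.
set G := expR (- _); set X := expR (_ / _) in eB *.
have G0 : 0 <= G by exact: expR_ge0.
have X1 : 1 <= X.
  by rewrite /X expR_ge1 // divr_ge0 ?mulr_ge0 // ltW.
have X0 : 0 <= X by exact: le_trans X1.
suff B : cabs ((z + h) * (cexp w - 1 - w) - h ^+ 2 * (3 * z + h) / (4 * t)%:C) <=
    cabs h ^+ 2 * ((6 * A ^+ 3 / t ^+ 2 + A / t) * X).
  rewrite [leRHS](_ : _ = heat_coef t * (G *
    (cabs h ^+ 2 * ((6 * A ^+ 3 / t ^+ 2 + A / t) * X)))); last by ring.
  by rewrite ler_wpM2l ?heat_coef_ge0 // ler_wpM2l.
apply: (le_trans (cabsD _ _)).
rewrite cabsN [in leRHS]mulrDl [in leRHS]mulrDr; apply: lerD.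
  rewrite cabsM.
  apply: (@le_trans _ _ ((2 * A) * (3 * (A * cabs h / t) ^+ 2 * X))).
    apply: ler_pM; rewrite ?cabs_ge0 //.
      by apply: (le_trans (cabsD _ _)); lra.
    apply: (le_trans (cexp_taylor2 _)); apply: ler_pM; rewrite ?expR_ge0 //.
      by rewrite mulr_ge0 // sqr_ge0.
    rewrite ler_wpM2l // lerXn2r ?nnegrE ?cabs_ge0 //.
    exact: le_trans (cabs_ge0 _) wB'.
  by rewrite le_eqVlt; apply/orP; left; apply/eqP; field; rewrite gt_eqF.
rewrite cabsM cabsM cabsX c4t -mulrA ler_wpM2l ?sqr_ge0 //.
apply: (@le_trans _ _ (A / t)); last by rewrite ler_peMr // divr_ge0 // ltW.
rewrite invfM mulrA ler_wpM2r ?invr_ge0 ?(ltW t0) //.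
rewrite ler_pdivrMr //; apply: (le_trans (cabsD _ _)).
rewrite cabsM cabs_nat; lra.
Qed.

End HeatKernel.

(** * Uniform bounds over the translates *)

Section HeatBounds.
Context {R : realType}.
Implicit Types (z w h : R[i]) (t T e : R) (n : int).

(** Every translate of the diamond lies in one of the sectors [|Im z| < |Re z|], and
    the distance of [z] to the boundary makes the gap [|Re| - |Im|] grow linearly
    with the translation.  This gives the Gaussian decay of the terms of
    [dxtheta]. *)
Lemma diamond_shift z : diamond z -> exists e, 0 < e /\ forall n,
  cabs (z + 2 * n%:~R) <= 2 * abs1p n /\
  (e * abs1p n) ^+ 2 <= complex.Re ((z + 2 * n%:~R) ^+ 2).
Proof.
rewrite /diamond /=; set x := complex.Re z; set y := complex.Im z.
move=> [y1 y2].
pose e := (Num.min (x - `|y|) (2 - x - `|y|)) / 2.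
have [m0 m1 m2] : [/\ 0 < e, 2 * e <= x - `|y| & 2 * e <= 2 - x - `|y|].
  have E : 2 * e = Num.min (x - `|y|) (2 - x - `|y|).
    by rewrite /e mulrC divfK.
  split; last 2 first.
  - by rewrite E ge_min lexx.
  - by rewrite E ge_min lexx orbT.
  by rewrite divr_gt0 // lt_min !subr_gt0 y1 y2.
exists e; split => // n.
have y0 : 0 <= `|y| by [].
have Rez : complex.Re (z + 2 * n%:~R) = x + 2 * n%:~R by rewrite !ReImE /x; ring.
have Imz : complex.Im (z + 2 * n%:~R) = y by rewrite !ReImE /y; ring.
have key : `|x + 2 * n%:~R| - `|y| >= e * abs1p n /\
    `|x + 2 * n%:~R| + `|y| <= 2 * abs1p n.
  rewrite /abs1p; case: n {Rez Imz} => k.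
    have k0 : 0 <= k%:R :> R by [].
    rewrite absz_nat -pmulrn ger0_norm; last by lra.
    split; last by lra.
    have : e * k%:R <= k%:R by rewrite ler_piMl //; lra.
    lra.
  have k0 : 0 <= k%:R :> R by [].
  rewrite NegzE abszN absz_nat mulrNz -pmulrn -natr1 ler0_norm; last by lra.
  split; last by lra.
  have : e * k%:R <= k%:R by rewrite ler_piMl //; lra.
  lra.
case: key => k1 k2; split.
  by apply: (le_trans (cabs_le _)); rewrite Rez Imz.
rewrite expr2 ReM Rez Imz -!expr2.
rewrite -(real_normK (num_real (x + _))) -(real_normK (num_real y)).
have e0 : 0 <= e * abs1p n by rewrite mulr_ge0 ?(ltW m0) // (le_trans _ (abs1p_ge1 n)).
move: k1 e0; move: (e * abs1p n) (`|x + _|) (`|y|) y0 => a b c c0 k1 a0.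
have -> : b ^+ 2 - c ^+ 2 = (b - c) ^+ 2 + 2 * c * (b - c) by ring.
have h1 : a ^+ 2 <= (b - c) ^+ 2 by rewrite lerXn2r ?nnegrE ?(le_trans a0).
have h2 : 0 <= 2 * c * (b - c) by rewrite !mulr_ge0 // (le_trans a0).
lra.
Qed.

(** The fourth power suffices to compensate the [t^-4] that the coefficient and the
    remainder of [dxK_taylor] produce. *)
Lemma expR_decay (x : R) : 0 < x -> expR (- x) <= 256 / x ^+ 4.
Proof.
move=> x0; rewrite ler_pdivlMr ?exprn_gt0 // expRN mulrC.
rewrite ler_pdivrMr ?expR_gt0 //.
have -> : expR x = expR (x / 4) ^+ 4.
  by rewrite -expRM_natr; congr expR; field.
have h : x / 4 <= expR (x / 4).
  by apply: le_trans (expR_ge1Dx _); rewrite lerDr.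
rewrite (_ : x ^+ 4 = 256 * (x / 4) ^+ 4); last by field.
rewrite ler_pM2l //; apply: lerXn2r => //; rewrite nnegrE ?expR_ge0 //.
by apply: divr_ge0 => //; exact: ltW.
Qed.

(** The Gaussian beats the negative powers of [t], uniformly on bounded time
    intervals; the decay in [N] gives the convergence of the series over the
    translates. *)
Lemma heat_decay T e : 0 < T -> 0 < e -> exists C, 0 <= C /\ forall t N,
  0 < t < T -> 1 <= N ->
  heat_coef t * (N ^+ 3 / t ^+ 2) * expR (- ((e * N) ^+ 2 / (8 * t))) <=
  C * N ^- 2.
Proof.
move=> T0 e0; pose K := heat_coef 1 * Num.sqrt T.
have K0 : 0 <= K by rewrite mulr_ge0 ?heat_coef_ge0 // sqrtr_ge0.
have c0 : 0 <= 2 ^+ 20 / e ^+ 8.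
  by apply: divr_ge0; apply: exprn_ge0 => //; exact: ltW.
exists (K * (2 ^+ 20 / e ^+ 8)); split; first exact: mulr_ge0.
move=> t N tT N1; have /andP[t0 _] := tT.
have N0 : 0 < N by exact: lt_le_trans N1.
have x0 : 0 < (e * N) ^+ 2 / (8 * t) by rewrite divr_gt0 ?exprn_gt0 ?mulr_gt0.
have kb : heat_coef t <= K / t ^+ 2 by exact: heat_coef_bound tT.
apply: (@le_trans _ _ ((K / t ^+ 2) * (N ^+ 3 / t ^+ 2) *
    (256 / ((e * N) ^+ 2 / (8 * t)) ^+ 4))).
  apply: ler_pM; rewrite ?expR_ge0 ?expR_decay //.
    by rewrite mulr_ge0 ?heat_coef_ge0 // divr_ge0 ?exprn_ge0 // ltW.
  by rewrite ler_wpM2r // divr_ge0 ?exprn_ge0 // ltW.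
rewrite [leLHS](_ : _ = K * (2 ^+ 20 / e ^+ 8) * N ^- 5); last first.
  by field; rewrite !gt_eqF.
apply: ler_wpM2l; first exact: mulr_ge0.
by rewrite lef_pV2 ?posrE ?exprn_gt0 // ler_weXn2l.
Qed.

(** In [dxK_taylor], [d] is chosen so small that the increment of the exponent takes
    at most half of the Gaussian decay given by [diamond_shift]; the other half is
    what [heat_decay] uses, whence the [8 * t] there. *)
Lemma heat_bounds z T : diamond z -> 0 < T -> exists C d, [/\ 0 <= C, 0 < d &
  forall n t, 0 < t < T ->
  [/\ cabs (dxK (z + 2 * n%:~R) t) <= C * int_weight n,
      cabs (dxxK (z + 2 * n%:~R) t) <= C * int_weight n &
      forall h, cabs h <= d ->
        cabs (dxK (z + 2 * n%:~R + h) t - dxK (z + 2 * n%:~R) t -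
              h * dxxK (z + 2 * n%:~R) t) <= cabs h ^+ 2 * (C * int_weight n)]].
Proof.
move=> /diamond_shift[e [e0 zn]] T0.
have [C [C0 HC]] := heat_decay T0 e0.
pose M := 2 * T ^+ 2 + 4 * T + 48.
have T2 : 0 <= T ^+ 2 by rewrite sqr_ge0.
have M0 : 0 <= M by rewrite /M; lra.
exists (M * C), (Num.min 1 (e ^+ 2 / 12)); split.
- exact: mulr_ge0.
- by rewrite lt_min ltr01 divr_gt0 // exprn_gt0.
move=> n t tT; have /andP[t0 tT'] := tT.
have [zA zQ] := zn n; set Z := z + _ in zA zQ *.
set N := abs1p n in zA zQ; have N1 : 1 <= N := abs1p_ge1 n.
have N0 : 0 < N by exact: lt_le_trans N1.
have HCn := HC t N tT N1; rewrite /int_weight -/N.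
have N3 : N <= N ^+ 3 by rewrite -[leLHS]expr1 ler_weXn2l.
have N23 : N ^+ 2 <= N ^+ 3 by rewrite ler_weXn2l.
have N13 : 1 <= N ^+ 3 by rewrite exprn_ege1.
have t20 : 0 < t ^+ 2 by rewrite exprn_gt0.
have tT2 : t ^+ 2 <= T ^+ 2 by rewrite lerXn2r ?nnegrE ?(ltW t0) ?(ltW T0) // ltW.
pose X := expR (- ((e * N) ^+ 2 / (8 * t))).
have k0 := heat_coef_ge0 t.
(* every bound has the form [p * X] with [p] at most [M * N^3 / t^2] *)
have fin (a p : R) : a <= heat_coef t * p * X -> p <= M * (N ^+ 3 / t ^+ 2) ->
    a <= M * C * N ^- 2.
  move=> ap pM; apply: (le_trans ap).
  apply: (@le_trans _ _ (M * (heat_coef t * (N ^+ 3 / t ^+ 2) * X))).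
    rewrite [leRHS](_ : _ = heat_coef t * (M * (N ^+ 3 / t ^+ 2)) * X); last by ring.
    by rewrite ler_wpM2r ?expR_ge0 // ler_wpM2l.
  by rewrite -[leRHS]mulrA ler_wpM2l.
have expX a : a <= - ((e * N) ^+ 2 / (8 * t)) -> expR a <= X.
  by rewrite ler_expR.
have t80 : 0 < 8 * t by rewrite mulr_gt0.
have gauss : expR (- (complex.Re (Z ^+ 2) / (4 * t))) <= X.
  apply: expX; rewrite lerN2 ler_pdivrMr // mulrAC.
  rewrite ler_pdivlMr ?mulr_gt0 //.
  have := sqr_ge0 (e * N) => q0.
  rewrite [leRHS](_ : _ = (2 * complex.Re (Z ^+ 2)) * (4 * t)); last by ring.
  by rewrite ler_pM2r ?mulr_gt0 //; lra.
have c2t : cabs ((2 * t)%:C : R[i])^-1 = (2 * t)^-1.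
  by rewrite cabsV cabs_real gtr0_norm // mulr_gt0.
split.
- rewrite dxKE 2!cabsM cabsN cabs_real ger0_norm // cabs_heat.
  apply: (@fin _ (2 * N)).
    by rewrite -mulrA ler_wpM2l // ler_pM // ?cabs_ge0 ?expR_ge0.
  rewrite mulrA ler_pdivlMr // /M.
  have h1 : N * t ^+ 2 <= N ^+ 3 * T ^+ 2 by rewrite ler_pM // ltW.
  have h2 : 0 <= N ^+ 3 * T by rewrite mulr_ge0 ?(ltW T0) // (le_trans _ N13).
  lra.
- rewrite /dxxK 2!cabsM cabsN cabs_real ger0_norm // cabs_heat mulrA.
  apply: (@fin _ (1 + (2 * N) ^+ 2 / (2 * t))).
    rewrite ler_pM ?expR_ge0 ?mulr_ge0 ?cabs_ge0 // ler_wpM2l //.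
    apply: (le_trans (cabsD _ _)); rewrite cabsN cabsM c2t cabsX.
    rewrite -[cabs 1]/(cabs (1%:R)) cabs_nat lerD2l.
    rewrite ler_wpM2r ?invr_ge0 ?mulr_ge0 ?(ltW t0) //.
    by rewrite lerXn2r ?nnegrE ?cabs_ge0 // mulr_ge0 // ltW.
  rewrite mulrA ler_pdivlMr // /M.
  rewrite [leLHS](_ : _ = t ^+ 2 + 2 * N ^+ 2 * t); last by field; rewrite gt_eqF.
  have h1 : 1 * t ^+ 2 <= N ^+ 3 * T ^+ 2 by rewrite ler_pM // ltW.
  have h2 : N ^+ 2 * t <= N ^+ 3 * T by rewrite ler_pM ?sqr_ge0 // ltW.
  have h3 : 0 <= N ^+ 3 * T ^+ 2 by rewrite mulr_ge0 // (le_trans _ N13).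
  have h4 : 0 <= N ^+ 3 * T by rewrite mulr_ge0 ?(ltW T0) // (le_trans _ N13).
  lra.
move=> h; rewrite le_min => /andP[hd1 hd2].
have N2 : 1 <= 2 * N by lra.
apply: (le_trans (dxK_taylor t0 N2 zA hd1)).
rewrite ler_wpM2l ?sqr_ge0 //.
apply: (@fin _ (6 * (2 * N) ^+ 3 / t ^+ 2 + 2 * N / t)).
  rewrite ler_wpM2l //.
    by rewrite mulr_ge0 // addr_ge0 // divr_ge0 ?(ltW t0) ?exprn_ge0 //; lra.
  apply: expX.
  rewrite ler_pdivrMr ?mulr_gt0 // [leRHS](_ : _ = - ((e * N) ^+ 2 / 2)); last first.
    by field; rewrite gt_eqF.
  have : 3 * (2 * N) * cabs h <= (e * N) ^+ 2 / 2; last by lra.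
  apply: (@le_trans _ _ (3 * (2 * N) * (e ^+ 2 / 12))).
    by rewrite ler_wpM2l // mulr_ge0 //; lra.
  rewrite [leLHS](_ : _ = e ^+ 2 / 2 * N); last by field.
  rewrite [leRHS](_ : _ = e ^+ 2 / 2 * N ^+ 2); last by field.
  rewrite ler_wpM2l ?divr_ge0 ?sqr_ge0 //.
  by rewrite -[leLHS]expr1 ler_weXn2l.
rewrite mulrA ler_pdivlMr // /M.
rewrite [leLHS](_ : _ = 48 * N ^+ 3 + 2 * (N * t)); last by field; rewrite gt_eqF.
have h1 : N * t <= N ^+ 3 * T by rewrite ler_pM // ltW.
have h2 : 0 <= N ^+ 3 * T ^+ 2 by rewrite mulr_ge0 // (le_trans _ N13).
have h3 : 0 <= N ^+ 3 * T by rewrite mulr_ge0 ?(ltW T0) // (le_trans _ N13).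
lra.
Qed.

End HeatBounds.

(** * The control-to-state operator *)

Section HeatOperator.
Context {R : realType}.
Notation mu := (@lebesgue_measure R).
Implicit Types (z w h : R[i]) (t T e : R) (n : int).

Lemma cmeas_real (D : set R) (g : R -> R) : measurable_fun D g ->
  cmeasurable D (fun t => (g t)%:C).
Proof. by move=> mg; split => //; exact: measurable_cst. Qed.

Lemma cmeas_cexp (D : set R) (g : R -> R[i]) : cmeasurable D g ->
  cmeasurable D (fun t => cexp (g t)).
Proof.
move=> [m1 m2]; apply: cmeasM.
  by apply: cmeas_real; apply: measurableT_comp.
split => /=; apply: measurableT_comp m2 => //;
  apply: continuous_measurable_fun; [exact: continuous_cos|exact: continuous_sin].
Qed.

Lemma mem_itvT T t : `]0, T[%classic t -> 0 < T - t < T.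
Proof. by rewrite /= in_itv /= => /andP[t0 tT]; rewrite subr_gt0 tT ltrBlDr ltrDl. Qed.

Lemma meas_inv T : measurable_fun `]0, T[%classic (fun t => (T - t)^-1).
Proof.
apply: (eq_measurable_fun (fun t => (T - t) `^ (-1))).
  by move=> t /set_mem /mem_itvT /andP[t0 _]; rewrite powR_inv1 // ltW.
apply: (@measurableT_comp _ _ _ _ _ _ (fun x : R => x `^ (-1))).
  exact: measurable_powR.
by apply: measurable_funB => //; exact: measurable_cst.
Qed.

Lemma meas_heat_coef T : measurable_fun `]0, T[%classic (fun t => heat_coef (T - t)).
Proof.
apply: (eq_measurable_fun (fun t => (4 * Num.sqrt pi)^-1 * (T - t) `^ (- (3 / 2)))).
  by move=> t _; rewrite /heat_coef [in RHS]invfM powRN.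
apply: measurable_funM; first exact: measurable_cst.
apply: (@measurableT_comp _ _ _ _ _ _ (fun x : R => x `^ (- (3 / 2)))).
  exact: measurable_powR.
by apply: measurable_funB => //; exact: measurable_cst.
Qed.

Lemma cmeas_quot T (c : R) z :
  cmeasurable `]0, T[%classic (fun t => z / (c * (T - t))%:C).
Proof.
rewrite (_ : (fun t => _) = fun t => (z / c%:C) * ((T - t)^-1)%:C).
  apply: cmeasM; first exact: cmeas_cst.
  by apply: cmeas_real; exact: meas_inv.
by apply/funext => t; rewrite rmorphM invfM fmorphV /= mulrA.
Qed.

Lemma cmeas_heat T z :
  cmeasurable `]0, T[%classic (fun t => cexp (- (z ^+ 2 / (4 * (T - t))%:C))).
Proof.
apply: cmeas_cexp.
have := cmeasB (cmeas_cst `]0, T[%classic 0) (cmeas_quot T 4 (z ^+ 2)).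
by congr cmeasurable; apply/funext => t; rewrite sub0r.
Qed.

Lemma cmeas_heat_coef T :
  cmeasurable `]0, T[%classic (fun t => - (heat_coef (T - t))%:C).
Proof.
have := cmeasB (cmeas_cst `]0, T[%classic 0) (cmeas_real (@meas_heat_coef T)).
by congr cmeasurable; apply/funext => t; rewrite sub0r.
Qed.

Lemma cmeas_dxK T z : cmeasurable `]0, T[%classic (fun t => dxK z (T - t)).
Proof.
rewrite (_ : (fun t => _) = fun t => - (heat_coef (T - t))%:C *
  (z * cexp (- (z ^+ 2 / (4 * (T - t))%:C)))); last first.
  by apply/funext => t; rewrite dxKE.
apply: cmeasM; first exact: cmeas_heat_coef.
by apply: cmeasM; [exact: cmeas_cst|exact: cmeas_heat].
Qed.

Lemma cmeas_dxxK T z : cmeasurable `]0, T[%classic (fun t => dxxK z (T - t)).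
Proof.
apply: cmeasM; first exact: cmeas_heat_coef.
apply: cmeasM; last exact: cmeas_heat.
by apply: cmeasB; [exact: cmeas_cst|exact: cmeas_quot].
Qed.

Lemma measurable_time_itv T : measurable (`]0, T[%classic : set (measurableTypeR R)).
Proof. exact: measurable_itv. Qed.

Lemma time_itv_finite T : (mu `]0%R, T[%classic < +oo)%E.
Proof.
rewrite lebesgue_measure_itv /=; case: ifP => _; last exact: ltry.
by rewrite -EFinB ltry.
Qed.

Lemma L2P T u : L2 T u <-> L2on `]0, T[%classic u.
Proof.
split=> [[m1 m2 i]|[[m1 m2] /integrableP[_ i]]].
  split; first by split.
  apply/integrableP; split.
    by apply/measurable_EFinP; apply: meas_sqnorm.
  apply: le_lt_trans i; rewrite le_eqVlt; apply/orP; left; apply/eqP.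
  by apply: eq_integral => t _; rewrite /= ger0_norm ?sqnorm_ge0.
split => //; apply: le_lt_trans i; rewrite le_eqVlt; apply/orP; left; apply/eqP.
by apply: eq_integral => t _; rewrite /= ger0_norm ?sqnorm_ge0.
Qed.

Lemma L2normE T u : L2norm T u = Num.sqrt (sqn (L2ip `]0, T[%classic) u).
Proof. by rewrite sqn_L2ip. Qed.

(** The conjugate turns the integral defining [Lop T u z] into the inner product of
    [u] with this vector. *)
Definition representer T z (t : R) : R[i] := conjc (dxtheta z (T - t)).

Lemma LopE T u z : Lop T u z = L2ip `]0, T[%classic u (representer T z).
Proof.
by apply: eq_cintegral => t _; rewrite /representer conjcK mulrC.
Qed.

Lemma summ_int_weightZ (C : R) : rsummable (fun n => C * int_weight n).
Proof. apply: summZ; exact: summ_int_weight. Qed.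

Lemma L2on_bounded (D : set R) (mD : measurable (D : set (measurableTypeR R)))
    (fD : (mu D < +oo)%E) u b : cmeasurable D u ->
  (forall t, D t -> cabs (u t) <= b) -> L2on D u.
Proof.
move=> mu' ub; split => //; apply: (@rint_bounded _ _ mD fD _ (b ^+ 2)).
  exact: meas_sqnorm.
move=> t Dt; rewrite ger0_norm ?sqnorm_ge0 // -sqr_cabs.
by rewrite lerXn2r ?nnegrE ?cabs_ge0 ?ub // (le_trans (cabs_ge0 _) (ub t Dt)).
Qed.

(** A quantitative form of complex differentiability which, unlike the limit of
    difference quotients, passes through sums and integrals by dominating the
    constants. *)
Definition quad_differentiable (f : R[i] -> R[i]) z := exists l C d, 0 < d /\
  forall h, cabs h <= d -> cabs (f (z + h) - f z - h * l) <= C * cabs h ^+ 2.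

Section AtPoint.
Variables (T : R) (hT : 0 < T).
Let D := `]0, T[%classic.
Let mD := measurable_time_itv T.
Let fD := time_itv_finite T.

Lemma L2on_csum_heat (F : R[i] -> R -> R[i]) (C : R) z : 0 <= C ->
  (forall w, cmeasurable D (fun t => F w (T - t))) ->
  (forall n t, 0 < t < T -> cabs (F (z + 2 * n%:~R) t) <= C * int_weight n) ->
  L2on D (fun t => csum (fun n : int => F (z + 2 * n%:~R) (T - t))).
Proof.
move=> C0 mF FC.
have sB := summ_int_weightZ C.
have B0 n : 0 <= C * int_weight n by rewrite mulr_ge0 // int_weight_ge0.
apply: (@L2on_bounded _ mD fD _ (2 * nnsum (fun n => C * int_weight n))).
  apply: (@cmeas_csum _ _ mD fD _ (fun n t => F (z + 2 * n%:~R) (T - t)) _ sB B0) => //.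
  by move=> n t Dt; apply: FC; exact: mem_itvT.
move=> t Dt; apply: cabs_csum => // n; apply: FC; exact: mem_itvT.
Qed.

Lemma L2on_dxtheta z : diamond z -> L2on D (fun t => dxtheta z (T - t)).
Proof.
move=> /heat_bounds /(_ hT) [C [d [C0 d0 H]]].
apply: (L2on_csum_heat C0 (cmeas_dxK T)) => n t /(H n)[]//.
Qed.

Lemma L2on_conjc u : L2on D u -> L2on D (fun t => conjc (u t)).
Proof.
move=> [m1 i1]; split; first exact: cmeas_conjc.
by move: i1; congr rintegrable; apply/funext => t; rewrite sqnorm_conjc.
Qed.

Lemma L2on_representer z : diamond z -> L2on D (representer T z).
Proof. by move=> /L2on_dxtheta; exact: L2on_conjc. Qed.

Lemma cint_L2 u v : L2on D u -> L2on D v -> cintegrable D (fun t => u t * v t).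
Proof.
move=> Lu Lv; have := L2on_mul mD Lu (L2on_conjc Lv).
by congr cintegrable; apply/funext => t; rewrite conjcK.
Qed.

(** The bounds of [heat_bounds] do not depend on the time and are summable over the
    translates, so the expansion of [dxK] can be summed and integrated against
    [u]. *)
Lemma Lop_quad_differentiable u z : L2on D u -> diamond z ->
  quad_differentiable (Lop T u) z.
Proof.
move=> Lu /heat_bounds /(_ hT) [C [d [C0 d0 H]]].
have Lth : L2on D (fun t => dxtheta z (T - t)).
  by apply: (L2on_csum_heat C0 (cmeas_dxK T)) => n t /(H n)[].
pose G t := csum (fun n : int => dxxK (z + 2 * n%:~R) t).
have LG : L2on D (fun t => G (T - t)).
  by apply: (L2on_csum_heat C0 (cmeas_dxxK T)) => n t /(H n)[].
pose B n := C * int_weight n; have sB : rsummable B := summ_int_weightZ C.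
have iu : rintegrable D (fun t => cabs (u t)).
  have := cint_L2 (L2on_bounded mD fD (cmeas_cst D 1) (fun t _ => lexx _)) Lu.
  by move=> /(rint_cabs mD); congr rintegrable; apply/funext => t; rewrite mul1r.
pose K := 2 * nnsum B.
exists (cintegral D (fun t => G (T - t) * u t)),
  (2 * \int[mu]_(t in D) (K * cabs (u t))), d; split => // h hd.
pose B' n := B n + cabs h * B n + cabs h ^+ 2 * B n.
have zh n t : 0 < t < T -> cabs (dxK (z + h + 2 * n%:~R) t) <= B' n.
  move=> /(H n)[h1 h2 h3].
  rewrite [z + h + _]addrAC.
  rewrite -[dxK _ t](subrK (dxK (z + 2 * n%:~R) t + h * dxxK (z + 2 * n%:~R) t)).
  rewrite [X in cabs X]addrC; apply: (le_trans (cabsD _ _)); apply: lerD.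
    apply: (le_trans (cabsD _ _)); apply: lerD => //.
    by rewrite cabsM ler_wpM2l ?cabs_ge0.
  by rewrite opprD addrA; exact: h3.
have sB' : rsummable B' by apply: summD; [apply: summD => //|]; exact: summZ.
have Lzh : L2on D (fun t => dxtheta (z + h) (T - t)).
  apply: (@L2on_csum_heat dxK (C + cabs h * C + cabs h ^+ 2 * C)).
  - by rewrite !addr_ge0 // mulr_ge0 ?exprn_ge0 ?cabs_ge0.
  - exact: cmeas_dxK.
  - by move=> n t /(zh n); rewrite /B' /B !mulrA -!mulrDl.
have i1 := cint_L2 Lzh Lu; have i2 := cint_L2 Lth Lu; have i3 := cint_L2 LG Lu.
have E : Lop T u (z + h) - Lop T u z -
    h * cintegral D (fun t => G (T - t) * u t) =
    cintegral D (fun t => (dxtheta (z + h) (T - t) - dxtheta z (T - t) -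
      h * G (T - t)) * u t).
  have i12 := cint_lin mD (-1) i2 i1.
  have c2 := cintegral_lin mD (- h) i3 i12.
  rewrite (cintegral_lin mD (-1) i2 i1) in c2.
  rewrite -/(Lop T u z) -/(Lop T u (z + h)) -/D in c2.
  set I3 := cintegral D (fun t => G (T - t) * u t) in c2 *.
  rewrite (_ : _ - _ - _ = - h * I3 + (-1 * Lop T u z + Lop T u (z + h))).
    by rewrite -c2; apply: eq_cintegral => t _; ring.
  by move: (Lop T u z) (Lop T u (z + h)) I3 {c2} => a b c; ring.
rewrite E.
have pt t : 0 < t < T ->
    cabs (dxtheta (z + h) t - dxtheta z t - h * G t) <= cabs h ^+ 2 * K.
  move=> tT.
  have b1 n : cabs (dxK (z + 2 * n%:~R) t) <= B n by have [] := H n t tT.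
  have b2 n : cabs (dxxK (z + 2 * n%:~R) t) <= B n by have [] := H n t tT.
  have b0 n := zh n t tT.
  have sZ (c : R) : rsummable (fun n => c * B n) by exact: summZ.
  pose a1 n := -1 * dxK (z + 2 * n%:~R) t + dxK (z + h + 2 * n%:~R) t.
  have ba1 n : cabs (a1 n) <= B n + B' n.
    apply: (le_trans (cabsD _ _)); rewrite cabsM cabsN.
    by rewrite -[cabs 1]/(cabs 1%:R) cabs_nat mul1r lerD.
  have -> : dxtheta (z + h) t - dxtheta z t - h * G t =
      csum (fun n => - h * dxxK (z + 2 * n%:~R) t + a1 n).
    rewrite (csum_lin (- h) sB (summD sB sB') b2 ba1).
    rewrite (csum_lin (-1) sB sB' b1 b0).
    by rewrite mulNr mulN1r [RHS]addrC [X in X - _]addrC.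
  rewrite /K mulrCA -nnsumZ ?exprn_ge0 ?cabs_ge0 //; last first.
    by move=> n; rewrite mulr_ge0 // int_weight_ge0.
  apply: cabs_csum; first exact: sZ.
  move=> n; have [_ _ /(_ h hd)] := H n t tT.
  congr (cabs _ <= _); rewrite /a1 [z + h + _]addrAC; ring.
apply: (@le_trans _ _ (2 * \int[mu]_(t in D) (cabs h ^+ 2 * (K * cabs (u t))))).
  apply: (cabs_cintegral mD).
  - apply: cmeasM; last by case: Lu.
    have [m1 _] := Lzh; have [m2 _] := Lth; have [m3 _] := LG.
    apply: cmeasB; first exact: cmeasB.
    by apply: cmeasM => //; exact: cmeas_cst.
  - by do 2 apply: (rintZ mD).
  - move=> t Dt; rewrite cabsM mulrA ler_wpM2r ?cabs_ge0 //.
    by apply: pt; exact: mem_itvT.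
rewrite RintegralZl //; last exact: (rintZ mD).
by rewrite mulrCA mulrC.
Qed.

End AtPoint.

Lemma quad_differentiable_derivable (f : R[i] -> R[i]) z : quad_differentiable f z ->
  derivable (f : R[i]^o -> R[i]^o) z 1.
Proof.
move=> [l [C [d [d0 H]]]].
pose C' := `|C| + 1.
have C'0 : 0 < C' by rewrite ltr_wpDl.
apply/cvg_ex; exists (l : R[i]^o).
apply/cvgrPdist_lt => e e0.
have [er e0'] : e = (complex.Re e)%:C /\ 0 < complex.Re e.
  move: e0; rewrite ltcE /= => /andP[/eqP i0 r0]; split => //.
  by apply: complex_eq.
pose r := Num.min d (complex.Re e / C').
have r0 : 0 < r by rewrite lt_min d0 divr_gt0.
near=> h.
have h0 : h != 0 by near: h; exact: nbhs_dnbhs_neq.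
have hr : cabs h < r.
  have : `|h| < r%:C by near: h; apply: dnbhs0_lt; rewrite ltcR.
  by rewrite normr_cabs ltcR.
have hp : 0 < cabs h.
  by rewrite -ltcR -normr_cabs normr_gt0.
rewrite er /= [h%:A]mulr1 [h + z]addrC.
rewrite -[l](mulKf h0) -[_ *: _]/(h^-1 * _) -mulrBr normrM normr_cabs cabsV.
rewrite normr_cabs -rmorphM /= ltcR mulrC ltr_pdivrMr //.
rewrite -cabsN opprB; have /H hH : cabs h <= d.
  by apply/ltW/(lt_le_trans hr); rewrite ge_min lexx.
apply: (le_lt_trans hH).
apply: (@le_lt_trans _ _ (C' * cabs h ^+ 2)).
  by rewrite ler_wpM2r ?exprn_ge0 ?cabs_ge0 // /C' ler_wpDr // ler_norm.
rewrite expr2 mulrA ltr_pM2r // mulrC -ltr_pdivlMr //.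
by apply: (lt_le_trans hr); rewrite ge_min lexx orbT.
Unshelve. all: by end_near.
Qed.

End HeatOperator.

(** * The kernel in closed form *)

Section KernelIntegral.
Context {R : realType}.
Notation mu := (@lebesgue_measure R).
Implicit Types (z w s : R[i]) (t T : R).

(** The velocity of a curve: the variable is real, so this is not the complex
    derivative. *)
Definition is_cder (g : R -> R[i]) t (l : R[i]) :=
  is_derive t 1 (fun x => complex.Re (g x)) (complex.Re l) /\
  is_derive t 1 (fun x => complex.Im (g x)) (complex.Im l).

Lemma is_derive_ext (f g : R -> R) t (a b : R) : is_derive t 1 f a ->
  (forall x, f x = g x) -> a = b -> is_derive t 1 g b.
Proof. by move=> fa fg <-; rewrite (_ : g = f) //; apply/funext => x. Qed.

Lemma is_cder_ext (f g : R -> R[i]) t (a b : R[i]) : is_cder f t a ->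
  (forall x, f x = g x) -> a = b -> is_cder g t b.
Proof. by move=> fa fg <-; rewrite (_ : g = f) //; apply/funext => x. Qed.

Lemma is_cder_cst c t : is_cder (fun=> c) t 0.
Proof. by split; exact: is_derive_cst. Qed.

Lemma is_cder_real (h : R -> R) t (l : R) : is_derive t 1 h l ->
  is_cder (fun x => (h x)%:C) t l%:C.
Proof. by move=> hl; split => //; exact: is_derive_cst. Qed.

Lemma is_cderD f g t (a b : R[i]) : is_cder f t a -> is_cder g t b ->
  is_cder (fun x => f x + g x) t (a + b).
Proof.
move=> [f1 f2] [g1 g2]; split.
  by apply: (is_derive_ext (is_deriveD f1 g1)) => [x|]; rewrite ?ReD.
by apply: (is_derive_ext (is_deriveD f2 g2)) => [x|]; rewrite ?ImD.
Qed.

Lemma is_cderM f g t (a b : R[i]) : is_cder f t a -> is_cder g t b ->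
  is_cder (fun x => f x * g x) t (a * g t + f t * b).
Proof.
move=> [f1 f2] [g1 g2]; split.
  apply: (is_derive_ext (is_deriveB (is_deriveM f1 g1) (is_deriveM f2 g2))).
    by move=> x; rewrite ReM.
  by rewrite /GRing.scale /= ReD !ReM; ring.
apply: (is_derive_ext (is_deriveD (is_deriveM f1 g2) (is_deriveM f2 g1))).
  by move=> x; rewrite ImM.
by rewrite /GRing.scale /= ImD !ImM; ring.
Qed.

Lemma is_cder_cexp g t (a : R[i]) : is_cder g t a ->
  is_cder (fun x => cexp (g x)) t (cexp (g t) * a).
Proof.
move=> [g1 g2].
have de := is_cder_real (is_derive1_comp (is_derive_expR _) g1).
have dc : is_cder (fun x => cos (complex.Im (g x)) +i* sin (complex.Im (g x))) t
    ((- sin (complex.Im (g t)) * complex.Im a) +i*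
     (cos (complex.Im (g t)) * complex.Im a)).
  split => /=; first exact: (is_derive1_comp (is_derive_cos _) g2).
  exact: (is_derive1_comp (is_derive_sin _) g2).
apply: (is_cder_ext (is_cderM de dc)) => //.
by apply: complex_eq; rewrite /cexp !(ReD, ImD, ReM, ImM) /=; ring.
Qed.

Lemma is_derive_continuous (f : R -> R) t (a : R) : is_derive t 1 f a ->
  {for t, continuous f}.
Proof.
by move=> [fd _]; apply: differentiable_continuous; apply/derivable1_diffP.
Qed.

Lemma cvg_at_left_lin (f : R -> R) T (C : R) : f T = 0 ->
  (forall t, T - 1 < t -> t < T -> `|f t| <= C * (T - t)) ->
  f @ T^'- --> f T.
Proof.
move=> -> fC; apply/cvgrPdist_lt => e e0.
have K0 : 0 < `|C| + 1 by rewrite ltr_wpDl.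
near=> t.
have tT : t < T by near: t; exact: nbhs_left_lt.
have t1 : T - 1 < t by near: t; apply: nbhs_left_gt; rewrite gtrBl.
have t2 : T - e / (`|C| + 1) < t.
  by near: t; apply: nbhs_left_gt; rewrite gtrBl divr_gt0.
rewrite sub0r normrN; apply: (le_lt_trans (fC _ t1 tT)).
have tT0 : 0 < T - t by rewrite subr_gt0.
apply: (@le_lt_trans _ _ ((`|C| + 1) * (T - t))).
  by rewrite ler_wpM2r ?(ltW tT0) // ler_wpDr // ler_norm.
by rewrite mulrC -ltr_pdivlMr // ltrBlDr -ltrBlDl.
Unshelve. all: by end_near.
Qed.

(** Meant for integrands whose formula is singular at [T]: nothing is required of
    [F] and [f] there but continuity from the left. *)
Lemma FTC_left_open (f F : R -> R) T : 0 < T ->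
  (forall t, t < T -> is_derive t 1 F (f t)) ->
  (forall t, t < T -> {for t, continuous f}) ->
  F @ T^'- --> F T -> f @ T^'- --> f T ->
  \int[mu]_(t in `]0, T[) f t = F T - F 0.
Proof.
move=> T0 dF cf FT fT.
have wf : {within `[0, T], continuous f}.
  apply/continuous_within_itvP => //; split => //.
    by move=> t; rewrite in_itv /= => /andP[_ /cf].
  by apply: cvg_at_right_filter; apply: cf.
have iC : mu.-integrable `[0, T] (EFin \o f).
  by apply: continuous_compact_integrable => //; exact: segment_compact.
have iO : mu.-integrable `]0, T] (EFin \o f).
  apply: integrableS iC => // t; rewrite /= !in_itv /= => /andP[/ltW -> ->].
  by [].
rewrite Rintegral_itv_bndo_bndc; last first.
  apply: integrableS iO => // t; rewrite /= !in_itv /= => /andP[-> /ltW ->].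
  by [].
rewrite Rintegral_itv_obnd_cbnd // /Rintegral (@continuous_FTC2 _ f F 0 T T0 wf) //.
  split => //.
    by move=> t; rewrite in_itv /= => /andP[_ /dF []].
  by apply: cvg_at_right_filter; exact: is_derive_continuous (dF 0 T0).
move=> t; rewrite in_itv /= => /andP[_ /dF h].
by rewrite derive1E; exact: derive_val.
Qed.

(** With [v = 1 / (T - t)], the function [- cexp (- s v / 4) (4 v / s + 16 / s^2)] is
    a primitive of the integrand: as [v' = v^2], differentiating the exponential
    contributes [v^3 + 4 v^2 / s] times it, and the last term cancels against the
    derivative of the other factor.  As [Re s > 0], the exponential decay makes the
    integrand and the primitive tend to 0 at [T]. *)
Lemma heat_integral s T : 0 < T -> 0 < complex.Re s ->
  let f t := ((T - t) ^- 3)%:C * cexp (- (s / (4 * (T - t))%:C)) in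
  cintegrable `]0, T[%classic f /\ cintegral `]0, T[ f =
  cexp (- (s / (4 * T)%:C)) * (4 / (s * T%:C) + 16 / s ^+ 2).
Proof.
move=> T0 s0 f0.
have sn0 : s != 0.
  by apply: contraTneq s0 => ->; rewrite ltxx.
pose v t := (T - t)^-1.
pose g t := - (s / 4) * (v t)%:C.
pose P t := 4 / s * (v t)%:C + 16 / s ^+ 2.
pose f t := ((v t) ^+ 3)%:C * cexp (g t).
(* the last factor is 1 for [t != T]; it makes the primitive vanish at [T] *)
pose F t := - (cexp (g t) * P t) * (v t * (T - t))%:C.
have dv t : t < T -> is_derive t 1 v (v t ^+ 2).
  move=> tT.
  have d1 : is_derive t 1 (fun x : R => T - x) (- 1).
    by apply: (is_derive_ext (is_deriveB (is_derive_cst T t 1) (is_derive_id t 1)))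
      => //; rewrite sub0r.
  have tn : T - t != 0 by rewrite gt_eqF // subr_gt0.
  apply: (is_derive_ext (@is_deriveV _ (fun x => T - x) t _ 1 tn d1)) => //.
  by rewrite /v /GRing.scale /= mulrNN mulr1 exprVn.
have dg t : t < T -> is_cder g t (- (s / 4) * (v t ^+ 2)%:C).
  move=> tT; apply: (is_cder_ext (is_cderM (is_cder_cst (- (s / 4)) t)
    (is_cder_real (dv t tT)))) => //.
  by rewrite mul0r add0r.
have dP t : t < T -> is_cder P t (4 / s * (v t ^+ 2)%:C).
  move=> tT; apply: (is_cder_ext (is_cderD (is_cderM (is_cder_cst (4 / s) t)
    (is_cder_real (dv t tT))) (is_cder_cst (16 / s ^+ 2) t))) => //.
  by rewrite mul0r add0r addr0.
have vT t : t < T -> v t * (T - t) = 1.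
  by move=> tT; rewrite mulVf // gt_eqF // subr_gt0.
have dF t : t < T -> is_cder F t (f t).
  move=> tT.
  have du : is_derive t 1 (fun x : R => v x * (T - x)) 0.
    have d1 : is_derive t 1 (fun x : R => T - x) (- 1).
      by apply: (is_derive_ext (is_deriveB (is_derive_cst T t 1) (is_derive_id t 1)))
        => //; rewrite sub0r.
    apply: (is_derive_ext (is_deriveM (dv t tT) d1)) => //.
    rewrite /GRing.scale /= mulrN1 [X in _ + X]mulrC expr2 -mulrA vT //.
    by rewrite mulr1 addNr.
  apply: (is_cder_ext (is_cderM (is_cderM (is_cder_cst (-1) t)
    (is_cderM (is_cder_cexp (dg t tT)) (dP t tT))) (is_cder_real du))).
    by move=> x; rewrite /F mulN1r.
  rewrite vT // /f /P !rmorphXn /=.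
  by move: (cexp _) (v t)%:C => X V; field.
have Fv0 : v T = 0 by rewrite /v subrr invr0.
have FT : F T = 0 by rewrite /F Fv0 mul0r mulr0.
have fT : f T = 0 by rewrite /f Fv0 expr0n mul0r.
pose a := complex.Re s / 4.
have a0 : 0 < a by rewrite divr_gt0.
have gB t : t < T -> cabs (cexp (g t)) <= 256 / (a * v t) ^+ 4.
  move=> tT; rewrite cabs_cexp.
  have -> : complex.Re (g t) = - (a * v t).
    have q4 : (4^-1 : R[i]) = (4^-1 : R)%:C by rewrite fmorphV rmorph_nat.
    rewrite /g q4 /a ReM ReN ReM !Re_realc !Im_realc; ring.
  by apply: expR_decay; rewrite mulr_gt0 // invr_gt0 subr_gt0.
have small t (p : R[i]) (K : R) : t < T -> 0 <= K -> cabs p <= K * v t ^+ 3 ->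
    cabs (p * cexp (g t)) <= K * (256 / a ^+ 4) * (T - t).
  move=> tT K0 pK; have t0 : 0 < T - t by rewrite subr_gt0.
  rewrite cabsM; apply: (le_trans (ler_pM _ _ pK (gB t tT))); rewrite ?cabs_ge0 //.
  rewrite le_eqVlt; apply/orP; left; apply/eqP; rewrite /v.
  by field; rewrite !gt_eqF.
have fB t : t < T -> cabs (f t) <= 1 * (256 / a ^+ 4) * (T - t).
  move=> tT; apply: small => //; rewrite cabs_real ger0_norm ?mul1r //.
  by rewrite exprn_ge0 // invr_ge0 subr_ge0 ltW.
pose K := cabs (4 / s) + cabs (16 / s ^+ 2).
have FB t : T - 1 < t -> t < T -> cabs (F t) <= K * (256 / a ^+ 4) * (T - t).
  move=> t1 tT; rewrite /F vT // mulr1 cabsN [X in cabs X]mulrC.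
  apply: small => //; first by rewrite addr_ge0 ?cabs_ge0.
  have v1 : 1 <= v t.
    by rewrite /v invf_ge1 ?subr_gt0 // lerBlDr -lerBlDl ltW.
  rewrite /P /K [leRHS]mulrDl; apply: (le_trans (cabsD _ _)); apply: lerD.
    rewrite cabsM cabs_real ler_wpM2l ?cabs_ge0 // ger0_norm.
      by rewrite -[leLHS]expr1 ler_weXn2l.
    exact: le_trans v1.
  by rewrite ler_peMr ?cabs_ge0 // exprn_ege1.
have df t : t < T -> exists l, is_cder f t l.
  move=> tT; eexists; apply: is_cderM (is_cder_cexp (dg t tT)).
  apply: (is_cder_ext (is_cder_real (is_deriveM (dv t tT)
    (is_deriveM (dv t tT) (dv t tT))))) => //.
have E : cintegral `]0, T[ f = F T - F 0.
  apply: complex_eq.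
    rewrite Re_cintegral ReD ReN.
    apply: (@FTC_left_open (fun t => complex.Re (f t))
      (fun t => complex.Re (F t))) => //.
    - by move=> t /dF[].
    - by move=> t /df[l [h _]]; exact: is_derive_continuous h.
    - apply: cvg_at_left_lin; first by rewrite FT.
      by move=> t t1 tT; apply: le_trans (Re_cabs _) (FB t t1 tT).
    - apply: cvg_at_left_lin; first by rewrite fT.
      by move=> t t1 tT; apply: le_trans (Re_cabs _) (fB t tT).
  rewrite Im_cintegral ImD ImN.
  apply: (@FTC_left_open (fun t => complex.Im (f t)) (fun t => complex.Im (F t))) => //.
  - by move=> t /dF[].
  - by move=> t /df[l [_ h]]; exact: is_derive_continuous h.
  - apply: cvg_at_left_lin; first by rewrite FT.
    by move=> t t1 tT; apply: le_trans (Im_cabs _) (FB t t1 tT).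
  - apply: cvg_at_left_lin; first by rewrite fT.
    by move=> t t1 tT; apply: le_trans (Im_cabs _) (fB t tT).
have gE t : g t = - (s / (4 * (T - t))%:C).
  by rewrite /g /v rmorphM fmorphV rmorph_nat /= invfM mulNr mulrA.
have ff0 : f0 = f by apply/funext => t; rewrite /f0 /f gE /v exprVn.
rewrite ff0; split.
  have mf : cmeasurable `]0, T[%classic f.
    apply: cmeasM.
      by apply: cmeas_real; apply: measurable_funX; exact: meas_inv.
    apply: cmeas_cexp; have := cmeasM (cmeas_cst `]0, T[%classic (- (s / 4)))
      (cmeas_real (@meas_inv R T)).
    by [].
  have rc (c : R) : rintegrable `]0, T[%classic (fun=> c).
    exact: (@rint_bounded _ _ (measurable_time_itv T) (time_itv_finite T) _ `|c|).
  apply: (cint_le (measurable_time_itv T) mf (rc (256 / a ^+ 4 * T))).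
  move=> t; rewrite /= in_itv /= => /andP[t0 tT].
  apply: (le_trans (fB t tT)); rewrite mul1r.
  apply: ler_wpM2l; last by rewrite gerBl ltW.
  by apply: divr_ge0 => //; apply: exprn_ge0; exact: ltW.
rewrite E FT sub0r /F vT // mulr1 opprK gE /P /v subr0; congr (_ * (_ + _)).
by rewrite fmorphV invfM mulrA.
Qed.

Lemma cintegralZ (D : set R) (mD : measurable (D : set (measurableTypeR R)))
    (fD : (mu D < +oo)%E) c f : cintegrable D f ->
  cintegral D (fun t => c * f t) = c * cintegral D f.
Proof.
move=> cf.
have c0 : cintegrable D (fun=> 0).
  by split; apply: (@rint_bounded _ _ mD fD _ 0) => [|t _];
    rewrite ?normr0 //; exact: measurable_cst.
have I0 : cintegral D (fun=> 0 : R[i]) = 0.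
  by apply: complex_eq; rewrite ?Re_cintegral ?Im_cintegral Rintegral_cst // mul0r.
have := cintegral_lin mD c cf c0; rewrite I0 addr0 => <-.
by apply: eq_cintegral => t _; rewrite addr0.
Qed.

Lemma heat_coefX2 t : 0 < t -> heat_coef t ^+ 2 = (16 * pi)^-1 * t ^- 3.
Proof.
move=> t0; rewrite /heat_coef exprVn !exprMn sqr_sqrtr ?pi_ge0 // -invfM.
congr (_^-1); have -> : t `^ (3 / 2) ^+ 2 = t ^+ 3.
  rewrite -powR_mulrn ?powR_ge0 // -powRrM -powR_mulrn ?ltW //.
  by congr (_ `^ _); field.
by ring.
Qed.

Lemma conjc_divr z (x : R) : conjc (z / x%:C) = conjc z / x%:C.
Proof. by rewrite -fmorphV rmorphM; congr (_ * _); exact: conjc_real. Qed.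

(** The two exponentials combine into one with [s = z^2 + conjc w^2], and the squared
    coefficient is [1 / (16 pi t^3)]. *)
Lemma dxK_kernel0 z w T : 0 < T -> 0 < complex.Re (z ^+ 2) ->
  0 < complex.Re (w ^+ 2) ->
  cintegral `]0, T[ (fun t => dxK z (T - t) * conjc (dxK w (T - t))) =
  kernel0 T z w.
Proof.
move=> T0 z0 w0; set s := z ^+ 2 + conjc w ^+ 2.
have s0 : 0 < complex.Re s.
  by rewrite /s ReD -rmorphXn Re_conjc addr_gt0.
have sn0 : s != 0 by apply: contraTneq s0 => ->; rewrite ltxx.
have pi0 : (pi%:C : R[i]) != 0 by rewrite fmorph_eq0 gt_eqF // pi_gt0.
have TC : (T%:C : R[i]) != 0 by rewrite fmorph_eq0 gt_eqF.
pose c := z * conjc w / (16 * pi%:C).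
pose f t := ((T - t) ^- 3)%:C * cexp (- (s / (4 * (T - t))%:C)).
have E t : `]0, T[%classic t ->
    dxK z (T - t) * conjc (dxK w (T - t)) = c * f t.
  move=> /mem_itvT /andP[t0 _]; rewrite !dxKE /f.
  have -> : s / (4 * (T - t))%:C = z ^+ 2 / (4 * (T - t))%:C +
      conjc (w ^+ 2 / (4 * (T - t))%:C).
    by rewrite conjc_divr rmorphXn /= -mulrDl.
  have cdxK (k : R) (X : R[i]) :
      conjc (- k%:C * (w * X)) = - k%:C * (conjc w * conjc X).
    by rewrite 2!rmorphM rmorphN; congr (- _ * _); exact: conjc_real.
  rewrite cdxK opprD cexpD -(rmorphN conjc) cexp_conjc.
  have k2 : (heat_coef (T - t))%:C ^+ 2 = (16 * pi%:C)^-1 * ((T - t) ^- 3)%:C.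
    by rewrite -rmorphXn heat_coefX2 // rmorphM fmorphV rmorphM rmorph_nat.
  move: (cexp (- (z ^+ 2 / _))) (conjc (cexp (- (w ^+ 2 / _)))) => X Y.
  rewrite /c; move: ((T - t) ^- 3)%:C k2 => t3 k2.
  rewrite [RHS](_ : _ = (16 * pi%:C)^-1 * t3 * (z * conjc w) * (X * Y));
    last by ring.
  by rewrite -k2; ring.
rewrite (@eq_cintegral _ _ _ (fun t => c * f t)) //.
have [cf If] := heat_integral T0 s0.
rewrite (cintegralZ (measurable_time_itv T) (time_itv_finite T)) //.
rewrite If /kernel0 /= -/s /c.
rewrite rmorphM rmorph_nat /=; move: (cexp _) => X.
clear f E cf If s0; clearbody s.
move: (T%:C) TC (pi%:C) pi0 (conjc w) => t1 h1 p1 h2 w'.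
by field; rewrite h1 h2 sn0.
Qed.

End KernelIntegral.

(** * The reachable space *)

Lemma hilbert_function_space_scale {R : realType} (X : set R[i])
    (H : set (R[i] -> R[i])) ip (c : R) : 0 < c ->
  hilbert_function_space X H ip ->
  hilbert_function_space X H (fun f g => c%:C * ip f g).
Proof.
move=> c0 /hilbert_function_spaceP[ph cpl res def].
have sE f : sqn (fun f g => c%:C * ip f g) f = c * sqn ip f.
  by rewrite /sqn ReM Re_realc Im_realc mul0r subr0.
apply/hilbert_function_spaceP; split => //.
- split.
  + exact: ph_zero ph.
  + exact: ph_linear ph.
  + by move=> a f g h Hf Hg Hh; rewrite (ph_ipL ph) // mulrDr mulrCA.
  + by move=> f g Hf Hg; rewrite (ph_conj ph Hf Hg) rmorphM; congr (_ * _);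
      apply/esym; exact: conjc_real.
  + by move=> f Hf; rewrite mulr_ge0 ?(ph_ge0 ph) // ler0c ltW.
- move=> u Hu cau; have [|f Hf lim] := cpl u Hu.
  + move=> e e0; have [N hN] := cau (c * e) (mulr_gt0 c0 e0).
    exists N => m n Nm Nn; have := hN m n Nm Nn.
    by rewrite sE ltr_pM2l.
  exists f => // e e0; have [N hN] := lim (e / c) (divr_gt0 e0 c0).
  exists N => n Nn; rewrite sE mulrC -ltr_pdivlMr //; exact: hN.
- move=> f Hf /eqP; rewrite mulf_eq0 fmorph_eq0 gt_eqF //= => /eqP.
  exact: def.
Qed.

Section LeftReachable.
Context {R : realType}.
Notation mu := (@lebesgue_measure R).
Implicit Types (z w h : R[i]) (t T : R) (f u : R[i] -> R[i]).

(** [dxK_kernel0] applies to all pairs of translates because the squares of their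
    elements have positive real part. *)
Lemma kernel_leftE T z w : 0 < T -> diamond z -> diamond w ->
  kernel_left T z w = L2ip `]0, T[%classic (representer T w) (representer T z).
Proof.
move=> T0 Dz Dw.
have [C [d [C0 d0 Hz]]] := heat_bounds Dz T0.
have [C' [d' [C0' d0' Hw]]] := heat_bounds Dw T0.
have sz := summ_int_weightZ C; have sw := summ_int_weightZ C'.
pose F (nm : int * int) t := dxK (z + 2 * nm.1%:~R) (T - t) *
  conjc (dxK (w + 2 * nm.2%:~R) (T - t)).
pose B := pairfam (fun n => C * int_weight n : R) (fun n => C' * int_weight n).
have sB : rsummable B := summ_pair sz sw.
have B0 nm : 0 <= B nm by rewrite !mulr_ge0 // int_weight_ge0.
have bz n t : `]0, T[%classic t ->
    cabs (dxK (z + 2 * n%:~R) (T - t)) <= C * int_weight n.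
  by move=> /mem_itvT /(Hz n)[].
have bw n t : `]0, T[%classic t ->
    cabs (conjc (dxK (w + 2 * n%:~R) (T - t))) <= C' * int_weight n.
  by move=> /mem_itvT /(Hw n)[? _ _]; rewrite cabs_conjc.
have posz n : 0 < complex.Re ((z + 2 * n%:~R) ^+ 2).
  have [e [e0 /(_ n)[_]]] := diamond_shift Dz; apply: lt_le_trans.
  by rewrite exprn_gt0 // mulr_gt0 // (lt_le_trans ltr01) // abs1p_ge1.
have posw n : 0 < complex.Re ((w + 2 * n%:~R) ^+ 2).
  have [e [e0 /(_ n)[_]]] := diamond_shift Dw; apply: lt_le_trans.
  by rewrite exprn_gt0 // mulr_gt0 // (lt_le_trans ltr01) // abs1p_ge1.
rewrite /kernel_left.
rewrite (_ : (fun nm => _) = fun nm => cintegral `]0, T[%classic (F nm)); last first.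
  by apply/funext => nm; rewrite /F dxK_kernel0.
have mD := measurable_time_itv T; have fD := time_itv_finite T.
rewrite -(@cintegral_csum _ _ mD fD _ F B sB B0) //.
- apply: eq_cintegral => t Dt; rewrite /representer conjcK.
  have cj : conjc (dxtheta w (T - t)) =
      csum (fun m : int => conjc (dxK (w + 2 * m%:~R) (T - t))).
    rewrite -(csum_conjc sw) // => m.
    by have := bw m t Dt; rewrite cabs_conjc.
  rewrite cj mulrC.
  exact: (csum_pair sz sw (bz ^~ t ^~ Dt) (bw ^~ t ^~ Dt)).
- move=> [n m]; apply: cmeasM; first exact: cmeas_dxK.
  apply: cmeas_conjc; exact: cmeas_dxK.
- move=> [n m] t Dt; rewrite /F cabsM /B /pairfam /=.
  by apply: ler_pM; rewrite ?cabs_ge0 ?bz ?bw.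
Qed.

Lemma dxtheta_shift z t (m : int) : dxtheta (2 * m%:~R + z) t = dxtheta z t.
Proof.
rewrite /dxtheta -[RHS](@csum_reindex _ _ (fun n : int => n + m)); last first.
  by exists (fun n => n - m) => n; rewrite ?addrK ?subrK.
by congr csum; apply/funext => n; congr dxK; rewrite rmorphD /=; ring.
Qed.

Lemma dxK_opp z t : dxK (- z) t = - dxK z t.
Proof. by rewrite !dxKE sqrrN; ring. Qed.

Lemma dxtheta_opp T z t : 0 < t < T -> diamond z ->
  dxtheta (- z) t = - dxtheta z t.
Proof.
move=> tT Dz; have T0 : 0 < T by case/andP: tT => a b; exact: lt_trans b.
have [C [d [C0 d0 Hz]]] := heat_bounds Dz T0.
have sz := summ_int_weightZ C.
have bz n : cabs (dxK (z + 2 * n%:~R) t) <= C * int_weight n by have [] := Hz n t tT.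
have s0 : rsummable (fun _ : int => 0 : R).
  by have := summZ 0 sz; congr rsummable; apply/funext => n; rewrite mul0r.
have c0 (n : int) : cabs (0 : R[i]) <= 0 by rewrite (cabs_real 0) normr0.
have Z0 : csum (fun _ : int => 0 : R[i]) = 0.
  have E := csum_lin (-1) s0 s0 c0 c0.
  rewrite [X in _ = X + _]mulN1r addNr in E; rewrite -[RHS]E.
  by congr csum; apply/funext => n; rewrite mulr0 addr0.
have := csum_lin (-1) sz s0 bz c0; rewrite Z0 addr0 mulN1r => <-.
rewrite /dxtheta -[RHS](@csum_reindex _ _ (fun n : int => - n)); last first.
  by exists (fun n => - n) => n; rewrite opprK.
congr csum; apply/funext => n; rewrite addr0 mulN1r -dxK_opp; congr dxK.
by rewrite rmorphN /=; ring.
Qed.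

Lemma Lop_shift T (u : R -> R[i]) z (m : int) : Lop T u (2 * m%:~R + z) = Lop T u z.
Proof. by apply: eq_cintegral => t _; rewrite dxtheta_shift. Qed.

Lemma Lop_opp T (v : R -> R[i]) z : 0 < T -> L2on `]0, T[%classic v ->
  diamond z -> Lop T v (- z) = - Lop T v z.
Proof.
move=> T0 Lv Dz.
have i := cint_L2 (L2on_dxtheta T0 Dz) Lv.
rewrite /Lop -[RHS]mulN1r -(cintegralZ (measurable_time_itv T) (time_itv_finite T)) //.
apply: eq_cintegral => t /mem_itvT tT.
by rewrite (dxtheta_opp tT Dz) mulN1r mulNr.
Qed.

Lemma LopZ T c (v : R -> R[i]) z : 0 < T -> L2on `]0, T[%classic v ->
  diamond z -> Lop T (fun t => c * v t) z = c * Lop T v z.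
Proof.
move=> T0 Lv Dz; rewrite !LopE.
apply: (ipZl (L2on_pre_hilbert (measurable_time_itv T) (time_itv_finite T))) => //.
exact: L2on_representer.
Qed.

Lemma heat_solution0 T (v : R -> R[i]) z :
  heat_solution v (cst 0) z T = - 2 * Lop T v z.
Proof.
rewrite /heat_solution /Lop (_ : cintegral _ (fun tau => _ * cst 0 tau) = 0).
  by rewrite mulr0 addr0.
apply: complex_eq; rewrite ?Re_cintegral ?Im_cintegral.
  rewrite (@eq_Rintegral _ _ _ mu _ (cst 0)).
    by rewrite Rintegral_cst ?mul0r //; exact: measurable_itv.
  by move=> t _; rewrite mulr0.
rewrite (@eq_Rintegral _ _ _ mu _ (cst 0)).
  by rewrite Rintegral_cst ?mul0r //; exact: measurable_itv.
by move=> t _; rewrite mulr0.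
Qed.

Lemma diamond_open z : diamond z -> exists r : R, 0 < r /\
  forall h, cabs h <= r -> diamond (z + h).
Proof.
rewrite /diamond /= => -[z1 z2].
pose r := Num.min (complex.Re z - `|complex.Im z|)
  (2 - complex.Re z - `|complex.Im z|) / 4.
have m1 : 4 * r <= complex.Re z - `|complex.Im z|.
  by rewrite /r mulrC divfK // ge_min lexx.
have m2 : 4 * r <= 2 - complex.Re z - `|complex.Im z|.
  by rewrite /r mulrC divfK // ge_min lexx orbT.
have r0 : 0 < r by rewrite divr_gt0 // lt_min !subr_gt0 z1 z2.
exists r; split => // h hr.
have h1 : `|complex.Re h| <= r by exact: le_trans (Re_cabs _) hr.
have h2 : `|complex.Im h| <= r by exact: le_trans (Im_cabs _) hr.
have h3 : `|complex.Im (z + h)| <= `|complex.Im z| + `|complex.Im h|.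
  by rewrite ImD ler_normD.
move: h1; rewrite ler_norml => /andP[h4 h5].
by rewrite ReD; split; lra.
Qed.

Lemma chain_intro z (m : int) : diamond z -> diamond_chain (2 * m%:~R + z).
Proof. by move=> Dz; exists m => //; exists z. Qed.

Lemma chain_diamond z : diamond z -> diamond_chain z.
Proof.
move=> Dz; have := chain_intro 0 Dz.
by rewrite mulr0 add0r.
Qed.

Lemma chain_shift z : diamond_chain z -> diamond_chain (z + 2).
Proof.
move=> [m _ [d Dd <-]]; have := chain_intro (m + 1) Dd.
by congr diamond_chain; rewrite rmorphD /=; ring.
Qed.

Lemma diamond_flip z : diamond z -> diamond (2 - z).
Proof.
have hR : complex.Re (2 - z) = 2 - complex.Re z by rewrite !ReImE.
have hI : complex.Im (2 - z) = - complex.Im z by rewrite !ReImE; ring.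
by rewrite /diamond /= hR hI normrN => -[]; split; lra.
Qed.

(** Differentiability at a point of a translated diamond is read off at the
    corresponding point of the diamond itself. *)
Lemma Lop_derivable T (v : R -> R[i]) (f : R[i] -> R[i]) c z (m : int) : 0 < T ->
  L2on `]0, T[%classic v -> diamond z ->
  (exists2 r : R, 0 < r & forall h, cabs h <= r ->
    f (2 * m%:~R + z + h) = c * Lop T v (z + h)) ->
  derivable (f : R[i]^o -> R[i]^o) (2 * m%:~R + z) 1.
Proof.
move=> T0 Lv Dz [r r0 fE]; apply: quad_differentiable_derivable.
have [l [C [d [d0 H]]]] := Lop_quad_differentiable T0 Lv Dz.
exists (c * l), (cabs c * C), (Num.min r d); split; first by rewrite lt_min r0.
move=> h; rewrite le_min => /andP[hr hd].
have -> : f (2 * m%:~R + z) = c * Lop T v z.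
  by have := fE 0; rewrite !addr0; apply; rewrite (cabs_real 0) normr0 ltW.
rewrite fE // (_ : _ - _ - _ = c * (Lop T v (z + h) - Lop T v z - h * l)).
  by rewrite cabsM -mulrA ler_wpM2l ?cabs_ge0 // H.
by move: (Lop _ _ _) (Lop _ _ _) => A B; ring.
Qed.

End LeftReachable.

Theorem theorem1 (R : realType) (T : R) (hT : 0 < T) :
  (exists H ip, rkhs diamond (kernel_left T) H ip) /\
  forall (H : set (R[i] -> R[i]))
         (ip : (R[i] -> R[i]) -> (R[i] -> R[i]) -> R[i]),
    rkhs diamond (kernel_left T) H ip ->
    [/\ H `<=` hol diamond,
        left_reachable T =
          [set f | [/\ hol diamond_chain f,
                       forall z, diamond_chain z ->
                         f (z + 2) = f z /\ f z = - f (- z) &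
                       H (restr diamond f)]],
        exists2 ip', hilbert_function_space diamond H ip' &
          forall f, H f -> (hnorm ip' f)%:E = control_norm T f &
        forall f, H f -> (hnorm ip f)%:E = (2%:E * control_norm T f)%E].
Proof.
have mD := measurable_time_itv T; have fD := time_itv_finite T.
have ph := L2on_pre_hilbert mD fD; have cpl := L2on_complete mD fD.
have Lphi z : diamond z -> L2on `]0, T[%classic (representer T z).
  exact: L2on_representer.
have KE z w := @kernel_leftE R T z w hT.
split; first exact: (rkhs_exists ph cpl Lphi KE).
move=> H ip RK; have HF := rkhs_hilbert RK.
have res := hfs_restr HF.
have sub f : H f -> exists v, [/\ L2on `]0, T[%classic v,
    forall z, diamond z -> f z = Lop T v z &
    sqn (L2ip `]0, T[%classic) v <= sqn ip f].
  move=> Hf; have [v [Lv vE le]] := rkhs_sub ph cpl Lphi KE RK Hf.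
  by exists v; split => // z Dz; rewrite LopE vE.
have sup v : L2on `]0, T[%classic v -> exists f, [/\ H f,
    forall z, diamond z -> f z = Lop T v z &
    sqn ip f <= sqn (L2ip `]0, T[%classic) v].
  move=> Lv; have [f [Hf fE le]] := rkhs_sup ph Lphi KE RK Lv.
  by exists f; split => // z Dz; rewrite LopE fE.
have n2 : (- 2 : R[i]) != 0 by rewrite oppr_eq0 pnatr_eq0.
have sq2 : sqnorm (- 2 : R[i]) = 4 by rewrite /sqnorm !ReImE /=; ring.
have q2 : sqnorm ((- 2)^-1 : R[i]) = 4^-1.
  by rewrite -[LHS]sqr_cabs cabsV exprVn sqr_cabs sq2.
pose half (v : R -> R[i]) : R -> R[i] := fun t => (- 2)^-1 * v t.
have Lhalf v : L2on `]0, T[%classic v -> L2on `]0, T[%classic (half v).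
  by move=> Lv; exact: (ph_scale ph).
have Lop_half v z : L2on `]0, T[%classic v -> diamond z ->
    - 2 * Lop T (half v) z = Lop T v z.
  by move=> Lv Dz; rewrite LopZ // mulVKf.
have uniq f f' : H f -> H f' -> (forall z, diamond z -> f z = f' z) -> f = f'.
  by move=> Hf Hf' ff'; rewrite -(res f) // -(res f') //; exact: eq_restr.
(* [half v] is the control producing [Lop T v]; [sub] and [sup] give the two
   inequalities between its norm and that of [f] *)
have ncontrol f : H f -> control_norm T f = ((hnorm ip f) / 2)%:E.
  move=> Hf; apply/eqP; rewrite eq_le; apply/andP; split.
    have [v [Lv vE le]] := sub f Hf.
    apply: (@le_trans _ _ (L2norm T (half v))%:E).
      apply: ereal_inf_lbound; exists (half v) => //; split.
        by apply/L2P; exact: Lhalf.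
      by move=> z Dz; rewrite Lop_half // vE.
    rewrite lee_fin L2normE (sqn_scale ph) // q2 sqrtrM ?invr_ge0 //.
    have -> : Num.sqrt (4^-1 : R) = 2^-1.
      by rewrite (_ : 4^-1 = 2^-1 ^+ 2) ?sqrtr_sqr ?gtr0_norm //; field.
    by rewrite mulrC ler_pM2r ?invr_gt0 // ler_wsqrtr.
  apply: le_ereal_inf_tmp => _ [v [/L2P Lv vE] <-].
  rewrite lee_fin ler_pdivrMr //.
  have L2v := ph_scale ph (- 2) Lv.
  have [f' [Hf' f'E le]] := sup _ L2v.
  have <- : f' = f.
    by apply: uniq => // z Dz; rewrite f'E // vE // LopZ.
  rewrite L2normE /hnorm -/(sqn ip f').
  have -> : (2 : R) = Num.sqrt (sqnorm (- 2 : R[i])).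
    by rewrite sq2 (_ : 4 = 2 ^+ 2) ?sqrtr_sqr ?gtr0_norm //; ring.
  rewrite mulrC -sqrtrM ?sqnorm_ge0 // -(sqn_scale ph) //.
  exact: ler_wsqrtr.
split.
- move=> f Hf z Dz; have [v [Lv vE _]] := sub f Hf.
  have [r [r0 rD]] := diamond_open Dz.
  have := @Lop_derivable R T v f 1 z 0 hT Lv Dz.
  rewrite mulr0 add0r; apply; exists r => // h hr.
  by rewrite mul1r vE //; exact: rD.
- apply/seteqP; split => f.
    move=> [v /L2P Lv fE]; have {}fE z : diamond_chain z -> f z = - 2 * Lop T v z.
      by move=> /fE ->; exact: heat_solution0.
    split.
    + move=> _ [m _ [z Dz <-]].
      apply: (@Lop_derivable R T v f (- 2) z m hT Lv Dz).
      have [r [r0 rD]] := diamond_open Dz; exists r => // h hr.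
      rewrite -addrA fE; last exact/chain_intro/rD.
      by rewrite Lop_shift.
    + move=> _ [m _ [z Dz <-]]; have Cz := chain_intro m Dz.
      (* the chain is symmetric because [diamond] is invariant under [2 - z] *)
      have CNz : diamond_chain (- (2 * m%:~R + z)).
        have := chain_intro (- m - 1) (diamond_flip Dz).
        by congr diamond_chain; rewrite rmorphB rmorphN /=; ring.
      rewrite (fE _ Cz) (fE _ CNz) (fE _ (chain_shift Cz)).
      have -> : 2 * m%:~R + z + 2 = 2 * (m + 1)%:~R + z.
        by rewrite rmorphD /=; ring.
      have -> : - (2 * m%:~R + z) = 2 * (- m)%:~R + - z.
        by rewrite rmorphN /=; ring.
      by rewrite !Lop_shift Lop_opp // mulrN opprK.
    + have [f' [Hf' f'E _]] := sup _ (ph_scale ph (- 2) Lv).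
      rewrite (_ : restr _ _ = f') // -(res f') //; apply: eq_restr => z Dz.
      by rewrite f'E // LopZ // fE //; exact: chain_diamond.
  move=> [fh fper Hf]; have [v [Lv vE _]] := sub _ Hf.
  exists (half v); first by apply/L2P; exact: Lhalf.
  (* periodicity in forward steps only; backward ones are obtained by starting
     from the translated point *)
  have fshift z (m : nat) : diamond_chain z -> diamond_chain (z + 2 * m%:R) /\
      f (z + 2 * m%:R) = f z.
    move=> Cz; elim: m => [|m [IH1 IH2]]; first by rewrite mulr0 addr0.
    have -> : z + 2 * m.+1%:R = z + 2 * m%:R + 2 by rewrite -[m.+1%:R]natr1; ring.
    split; first exact: chain_shift.
    by have [-> _] := fper _ IH1.
  move=> _ [m _ [z Dz <-]]; rewrite heat_solution0 Lop_shift Lop_half //.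
  rewrite -vE // restrE //.
  case: m => m.
    rewrite addrC -pmulrn; exact: (fshift _ _ (chain_diamond Dz)).2.
  have Cz : diamond_chain (2 * (Negz m)%:~R + z) by exact: chain_intro.
  have [_ <-] := fshift _ m.+1 Cz; congr f.
  by rewrite NegzE mulrNz -pmulrn; ring.
- exists (fun f g => (4^-1)%:C * ip f g).
    by apply: hilbert_function_space_scale => //; rewrite invr_gt0.
  move=> f Hf; rewrite ncontrol //; congr EFin; rewrite /hnorm.
  rewrite ReM Re_realc Im_realc mul0r subr0 sqrtrM ?invr_ge0 //.
  have -> : Num.sqrt (4^-1 : R) = 2^-1.
    by rewrite (_ : 4^-1 = 2^-1 ^+ 2) ?sqrtr_sqr ?gtr0_norm //; field.
  by rewrite mulrC.
- move=> f Hf; rewrite ncontrol // -EFinM; congr EFin.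
  by rewrite mulrC divfK.
Qed.
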